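(* Let $d\ge1$, $S\in\tfrac12\mathbb{N}$, $u\in[0,1]$, $\beta>0$, $L$ even, $\Lambda=\{-\tfrac12L,\dots,\tfrac12L\}^d$, $\mathcal{E}_\Lambda$ the nearest-neighbour pairs in $\Lambda$, $\mathbf{h}=(h_x)_{x\in\Lambda}\in[0,\infty)^\Lambda$, and \[ H_{\Lambda,\mathbf{h}}=-\sum_{xy\in\mathcal{E}_\Lambda}\bigl(uT_{xy}+(1-u)Q_{xy}-1\bigr)-\sum_{x\in\Lambda}h_xS^3_x \] on $\bigotimes_{x\in\Lambda}\mathbb{C}^{2S+1}$, with $Z(\beta,\Lambda,\mathbf{h})=\operatorname{Tr}e^{-\beta H_{\Lambda,\mathbf{h}}}$ and $\langle M\rangle_{\Lambda,\mathbf{h}}=\operatorname{Tr}(Me^{-\beta H_{\Lambda,\mathbf{h}}})/Z(\beta,\Lambda,\mathbf{h})$. Then, with the random loop model defined in the context, and for $x\in\Lambda$, $x\neq0$: (a) $Z(\beta,\Lambda,\mathbf{h})=\int\rho(d\omega)\prod_{\gamma\in\mathcal{L}(\omega)}z_{\mathbf{h}}(\gamma)$; (b) $\langle S^1_0S^1_x\rangle_{\Lambda,\mathbf{h}}=\frac{1}{Z(\beta,\Lambda,\mathbf{h})}\int\rho(d\omega)\,1_{0\leftrightarrow x}(\omega)\,\tilde z_{\mathbf{h}}(\gamma_{0,x})\prod_{\gamma\in\mathcal{L}(\omega)\setminus\{\gamma_{0,x}\}}z_{\mathbf{h}}(\gamma)$.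
   Context: Spin operators: $|a\rangle$, $a=-S,\dots,S$, eigenbasis of $S^3$ with $S^3|a\rangle=a|a\rangle$; $S^1$ the standard spin-$S$ operator ($\langle a|S^1|b\rangle=\tfrac12\sqrt{S(S+1)-ab}$ if $a=b\pm1$, else $0$); $T_{xy}|a\rangle_x\otimes|b\rangle_y=|b\rangle_x\otimes|a\rangle_y$; $\langle a|_x\otimes\langle b|_yQ_{xy}|c\rangle_x\otimes|d\rangle_y=\delta_{a,b}\delta_{c,d}$. Random loops: regard $[0,\beta)$ as a circle of length $\beta$. Let $\rho$ be the joint law of two independent Poisson point processes on $\mathcal{E}_\Lambda\times[0,\beta)$ (with respect to counting measure times Lebesgue measure): a process of ''crosses'' of intensity $u$ and a process of ''double bars'' of intensity $1-u$; a realization is $\omega$. A bridge (cross or bar) at $(xy,t)$ joins the points $(x,t)$ and $(y,t)$. The realization $\omega$ decomposes $\Lambda\times[0,\beta)$ into disjoint loops, forming the collection $\mathcal{L}(\omega)$: starting at a point $(x,t)$ one moves vertically (in time, say upwards) until hitting an endpoint of a bridge, then jumps to the other endpoint of that bridge and continues in the same time direction if it was a cross, or in the reversed time direction if it was a double bar; the loop is complete upon returning to the start. For a loop $\gamma$ and $y\in\Lambda$, $\ell_y(\gamma)$ is the length (Lebesgue measure) of $\gamma\cap(\{y\}\times[0,\beta))$. $1_{0\leftrightarrow x}(\omega)$ is the indicator that $(0,0)$ and $(x,0)$ lie in the same loop, denoted $\gamma_{0,x}$. On this event, $\ell^+_y(\gamma_{0,x})$ is the vertical length at $y$ of the part of $\gamma_{0,x}$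 traversed starting at $(0,0)$ in the upward direction until the first visit to $(x,0)$, and $\ell^-_y(\gamma_{0,x})$ the vertical length at $y$ of the other part (from $(0,0)$ downwards to $(x,0)$), so $\ell_y=\ell^+_y+\ell^-_y$. Activities (sums over $a$ in steps of $1$): \[ z_{\mathbf{h}}(\gamma)=\sum_{a=-S}^{S}\exp\Bigl(a\sum_yh_y\ell_y(\gamma)\Bigr), \] \[ \tilde z_{\mathbf{h}}(\gamma_{0,x})=\tfrac14\sum_{a=-S}^{S-1}\bigl(S(S+1)-a(a+1)\bigr)\Bigl[e^{(a+1)\sum_yh_y\ell^+_y(\gamma_{0,x})+a\sum_yh_y\ell^-_y(\gamma_{0,x})}+e^{a\sum_yh_y\ell^+_y(\gamma_{0,x})+(a+1)\sum_yh_y\ell^-_y(\gamma_{0,x})}\Bigr]. \] *)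

(* Defs.v *)
From mathcomp Require Import all_boot all_order all_algebra.
From mathcomp Require Import all_classical all_reals all_analysis.
Set Implicit Arguments. Unset Strict Implicit. Unset Printing Implicit Defensive.
Import Order.TTheory GRing.Theory Num.Theory.
Import numFieldNormedType.Exports.

Local Open Scope ring_scope.

(* The box Lambda = {-L/2,...,L/2}^d with L = 2 l.  A site is a function     *)
(* 'I_d -> 'I_(2l+1); coordinate value i stands for the integer i - l, so    *)
(* the origin 0 of Z^d is the constant function l.                           *)
Notation site d l := {ffun 'I_d -> 'I_(l.*2.+1)}.

Definition origin (d l : nat) : site d l := [ffun _ => inord l].

Definition l1dist (d l : nat) (x y : site d l) : nat :=
  (\sum_(i < d) (((x i : nat) - y i) + ((y i : nat) - x i)))%N.

(* E_Lambda: unordered nearest-neighbour pairs, each represented once as an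
   ordered pair (x,y) with enum_rank x < enum_rank y. *)
Notation edge d l :=
  {p : site d l * site d l | (l1dist p.1 p.2 == 1)%N && (enum_rank p.1 < enum_rank p.2)%N}.

(* spin configurations: basis |sigma> of (C^(2S+1))^{tensor Lambda}, with
   2S = nS; the local index k : 'I_(nS+1) stands for the S^3 eigenvalue k - S *)
Notation conf d l nS := {ffun site d l -> 'I_nS.+1}.

Section Spin.
Context {R : realType} {d l : nat} (nS : nat).

Definition Sval : R := nS%:R / 2.
Definition spin (k : 'I_nS.+1) : R := k%:R - Sval.

Notation N := #|{: conf d l nS}|.

Definition opmx (f : conf d l nS -> conf d l nS -> R) : 'M[R]_N :=
  \matrix_(i, j) f (enum_val i) (enum_val j).

Definition swapc (x y : site d l) (t : conf d l nS) : conf d l nS :=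
  [ffun z => if z == x then t y else if z == y then t x else t z].

Definition Tmx (x y : site d l) : 'M[R]_N :=
  opmx (fun s t => (s == swapc x y t)%:R).

Definition Qmx (x y : site d l) : 'M[R]_N :=
  opmx (fun s t => [&& s x == s y, t x == t y &
                      [forall z, ((z != x) && (z != y)) ==> (s z == t z)]]%:R).

Definition S3mx (x : site d l) : 'M[R]_N :=
  opmx (fun s t => (s == t)%:R * spin (s x)).

Definition S1mx (x : site d l) : 'M[R]_N :=
  opmx (fun s t => [forall z, (z != x) ==> (s z == t z)]%:R *
     (if ((s x : nat) == (t x).+1) || ((t x : nat) == (s x).+1)
      then Num.sqrt (Sval * (Sval + 1) - spin (s x) * spin (t x)) / 2
      else 0)).

Definition Ham (u : R) (h : site d l -> R) : 'M[R]_N :=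
  - (\sum_(e : edge d l)
        (u *: Tmx (val e).1 (val e).2 + (1 - u) *: Qmx (val e).1 (val e).2 - 1))
  - \sum_(x : site d l) h x *: S3mx x.

End Spin.

Definition expmx {R : realType} (n : nat) (A : 'M[R]_n) : 'M[R]_n :=
  \matrix_(i, j) limn (fun K => \sum_(k < K) (A ^+ k) i j / (k`!)%:R).

Section Gibbs.
Context {R : realType} {d l : nat} (nS : nat).

Definition Zpart (u beta : R) (h : site d l -> R) : R :=
  \tr (expmx (- beta *: Ham nS u h)).

Definition corr11 (u beta : R) (h : site d l -> R) (x : site d l) : R :=
  \tr (S1mx nS (origin d l) *m S1mx nS x *m expmx (- beta *: Ham nS u h))
  / Zpart u beta h.

End Gibbs.

(* A realization omega is a finite list of bridges (e, b, t): edge e, kind b  *)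
(* (true = cross, false = double bar), time t in [0,beta).                    *)

(* n-point Janossy integrals of the joint Poisson process:
   ppint k G = sum_{(e_i,b_i)} prod_i w(b_i) int_{[0,beta)^k} G(...) dt,
   with w(cross) = u, w(bar) = 1 - u. *)
Fixpoint ppint {R : realType} (E : finType) (beta u : R) (k : nat)
    (G : seq (E * bool * R) -> \bar R) : \bar R :=
  match k with
  | 0 => G [::]
  | k'.+1 => (\sum_(eb : E * bool)
      ((if eb.2 then u else 1 - u)%:E *
       \int[@lebesgue_measure R]_(t in `[0%R, beta[%classic)
           ppint beta u k' (fun s => G ((eb, t) :: s))))%E
  end.

(* int rho(d omega) G(omega) for the joint law rho of the Poisson process of
   crosses (intensity u) and of double bars (intensity 1-u) on E x [0,beta):
   total intensity mass |E| beta. *)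
Definition rho_int {R : realType} (E : finType) (beta u : R)
    (G : seq (E * bool * R) -> \bar R) : \bar R :=
  (\sum_(n <oo) ((expR (- beta * #|{: E}|%:R) / (n`!)%:R)%:E * ppint beta u n G))%E.

Section Loops.
Context {R : realType} {d l : nat} (nS : nat) (beta : R) (h : site d l -> R)
        (s : seq (edge d l * bool * R)).

Notation n := (size s).
Definition br (i : 'I_n) := tnth (in_tuple s) i.

(* bridge endpoints: (bridge index, false = first site / true = second site) *)
Definition ep := ('I_n * bool)%type.
Definition ep_site (p : ep) : site d l :=
  let e := val (br p.1).1.1 in if p.2 then e.2 else e.1.
Definition ep_time (p : ep) : R := (br p.1).2.
Definition ep_cross (p : ep) : bool := (br p.1).1.2.

(* upward (cyclic, mod beta) time from endpoint p to endpoint q; = beta if q = p *)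
Definition gap (p q : ep) : R :=
  if ep_time p < ep_time q then ep_time q - ep_time p
  else ep_time q - ep_time p + beta.

Definition next (p : ep) : ep :=
  [arg min_(q < p | ep_site q == ep_site p) gap p q]%O.
Definition prev (q : ep) : ep :=
  [arg min_(p < q | ep_site p == ep_site q) gap p q]%O.

(* half-points: (endpoint, true = just above it / false = just below it).
   The vertical segment starting at p joins (p,true) and (next p,false). *)
Definition hp := (ep * bool)%type.

Definition M1 (g : hp) : hp := if g.2 then (next g.1, false) else (prev g.1, true).
(* jump along a bridge: a cross keeps the time direction, a bar reverses it *)
Definition M2 (g : hp) : hp :=
  let p' := (g.1.1, ~~ g.1.2) in if ep_cross g.1 then (p', ~~ g.2) else (p', g.2).

Definition lrel : rel hp :=
  fun g g' => [|| g' == M1 g, g' == M2 g, g == M1 g' | g == M2 g'].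

Definition loops : {set {set hp}} := [set [set g' | connect lrel g g'] | g : hp].

Definition segw (p : ep) : R := h (ep_site p) * gap p (next p).
(* sum_y h_y l_y(gamma) for the loop gamma represented by C *)
Definition loopw (C : {set hp}) : R := \sum_(p : ep | (p, true) \in C) segw p.
(* sites without bridge endpoints carry a loop {y} x [0,beta) *)
Definition empty_site (y : site d l) : bool := [forall p : ep, ep_site p != y].

Definition zact (w : R) : R := \sum_(k < nS.+1) expR (spin k * w).
Definition ztil (wp wm : R) : R :=
  4^-1 * \sum_(k < nS) (let a : R := k%:R - Sval nS in
     (Sval nS * (Sval nS + 1) - a * (a + 1)) *
     (expR ((a + 1) * wp + a * wm) + expR (a * wp + (a + 1) * wm))).

Definition weightA : R :=
  (\prod_(C in loops) zact (loopw C)) * \prod_(y | empty_site y) zact (h y * beta).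

(* endpoint at y whose upward segment contains time 0 (i.e. the point (y,0)) *)
Definition seg0 (y : site d l) : option ep :=
  [pick p : ep | (ep_site p == y) &&
                 [forall q : ep, (ep_site q == y) ==> (ep_time q <= ep_time p)]].

Definition weightB (x : site d l) : R :=
  match seg0 (origin d l), seg0 x with
  | Some p0, Some px =>
    if connect lrel (p0, true) (px, true) then
      let C0 := [set g' | connect lrel (p0, true) g'] in
      (* walk from (0,0) upwards: wk k = half-point through which the k-th
         subsequent segment is entered *)
      let wk := fun k => iter k (fun g => M2 (M1 g)) (M2 (next p0, false)) in
      let seg := fun g : hp => if g.2 then g.1 else prev g.1 in
      let K := find (fun k => seg (wk k) == px) (iota 0 (4 * n)) in
      (* sum_y h_y l^+_y(gamma_{0,x}) *)
      let wplus := h (origin d l) * ep_time (next p0)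
                   + \sum_(k < K) segw (seg (wk k))
                   + h x * (if (wk K).2 then beta - ep_time px
                            else ep_time (wk K).1) in
      (* sum_y h_y l^-_y(gamma_{0,x}) = sum_y h_y (l_y - l^+_y) *)
      let wminus := loopw C0 - wplus in
      ztil wplus wminus * (\prod_(C in loops | C != C0) zact (loopw C))
        * \prod_(y | empty_site y) zact (h y * beta)
    else 0
  | _, _ => 0
  end.

End Loops.

(* Main.v *)
Require Import Defs.
From mathcomp Require Import all_boot all_order all_algebra.
From mathcomp Require Import all_classical all_reals all_analysis.
From mathcomp Require Import measurable_realfun ring lra zify.
Set Implicit Arguments. Unset Strict Implicit. Unset Printing Implicit Defensive.
Import Order.TTheory GRing.Theory Num.Theory.
Import numFieldNormedType.Exports.
Local Open Scope ring_scope.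

(** A bridge inserts a swap or a projection, so expanding exp(-beta H) around the diagonal
    field term gives an integral over bridge configurations.  To get the unordered integrals
    of the Poisson process directly, let E_k(t) be the coefficient of x^k in
    exp(t (A + x B)), and let W_k(t, l) be the same coefficient once the insertions of l have
    been made.  Adding one more insertion and integrating its time over [0, t] multiplies the
    coefficient by its order: (k + 1) W_(k+1)(t, l) = sum_b w_b int_0^t W_k(t, l + (b, r)) dr.
    Hence the k-fold iterated integral of the time-ordered product is k! times E_k, with
    neither Fubini nor a symmetrization argument.

    For a fixed configuration with distinct times, the trace of the time-ordered product is a
    sum over spin labels on the half-points just above and just below the bridge endpoints.
    A label contributes only if it is constant along vertical segments and across bridges,
    i.e. on loops, so the sum factorizes over loops.  For the correlation, the two spin-flip
    operators at time 0 cut the segments through (0,0) and (x,0): if these lie in different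
    loops the label is still constant on both and the spin-flip matrix elements vanish;
    otherwise the loop splits into two arcs whose labels differ by one. *)

(** * Integrals over half-open intervals *)

(** The [-1] of each edge term, moved into the diagonal matrix [A], contributes exp(-beta |E|),
    which is also the void probability of the Poisson process. Both sides thus carry the same
    normalization, and only unnormalized weights remain to be compared. The loops are built from
    minimizers of cyclic gaps and are compared with the matrix product only when the bridge times
    are distinct and nonzero. At each level of the iterated integral this excludes finitely many
    times, and the integrand inherits measurability from the function it agrees with elsewhere.
    Labels sit on half-points rather than on segments because vertical segments and bridges then act
    as two involutions without fixed points: loops are orbits of the dihedral group they generate,
    and the reversal of time at a double bar needs no separate bookkeeping. The trace and the
    observable both act at time 0, so the field weight of a segment through time 0 is split there;
    this is what gives the two arcs of a cut loop their correct lengths. *)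

Section HasInt.
Context {R : realType}.
Implicit Types (f g F : R -> R) (a b c v : R).
Notation mu := (@lebesgue_measure R).

(** Integrability travels with the value, because additivity of the Lebesgue integral needs it at
    every use. *)
Definition hasint f a b v : Prop :=
  mu.-integrable `[a, b[%classic (EFin \o f) /\
  (\int[mu]_(x in `[a, b[%classic) (f x)%:E = v%:E)%E.

Lemma hasint_unique f a b v v' : hasint f a b v -> hasint f a b v' -> v = v'.
Proof. by move=> [_ e] [_ e']; apply: EFin_inj; rewrite -e -e'. Qed.

Lemma hasint_ext f g a b v : (forall x, a <= x < b -> f x = g x) ->
  hasint f a b v -> hasint g a b v.
Proof.
move=> fg [fi fv]; have e : {in `[a, b[%classic, forall x, f x = g x}.
  by move=> x; rewrite inE /= in_itv /=; exact: fg.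
split; first by apply: eq_integrable fi => // x xi /=; rewrite e.
by rewrite -fv; apply: eq_integral => x xi; rewrite e.
Qed.

Lemma hasint_scale f a b v k : hasint f a b v ->
  hasint (fun x => k * f x) a b (k * v).
Proof.
move=> [fi fv]; split; first exact: (integrableZl _ k fi).
by under eq_integral do rewrite EFinM; rewrite (integralZl _ fi)// fv.
Qed.

Lemma hasint_sum (I : Type) (s : seq I) (P : pred I) (f : I -> R -> R) a b (v : I -> R) :
  (forall i, hasint (f i) a b (v i)) ->
  hasint (fun x => \sum_(i <- s | P i) f i x) a b (\sum_(i <- s | P i) v i).
Proof.
move=> fv; pose g i x := (f i x)%:E.
have gi i : mu.-integrable `[a, b[%classic (g i) by have [] := fv i.
have mD : measurable (`[a, b[%classic : set (measurableTypeR R)) by [].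
split.
  have := integrable_sum mD s (P := P) (fun i _ => gi i).
  by apply: eq_integrable => // x _ /=; rewrite sumEFin.
under eq_integral do rewrite -sumEFin.
rewrite (integral_sum mD gi) -sumEFin; apply: eq_bigr => i _.
by have [] := fv i.
Qed.

Lemma hasint_cat f a b c v w : a <= b -> b <= c ->
  hasint f a b v -> hasint f b c w -> hasint f a c (v + w).
Proof.
move=> ab bc [fi fv] [gi gv].
have eU : (`[a, c[ = `[a, b[ `|` `[b, c[)%classic.
  by rewrite -itv_bndbnd_setU// bnd_simp.
have mf : measurable_fun (`[a, b[ `|` `[b, c[ : set (measurableTypeR R))%classic (EFin \o f).
  apply/measurable_funU => //; split; first exact: measurable_int fi.
  exact: measurable_int gi.
have dis : [disjoint `[a, b[%classic & `[b, c[%classic]%classic.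
  apply/disj_setPS => x /= []; rewrite !in_itv /= => /andP[_ xb] /andP[bx _].
  by move: xb; rewrite ltNge bx.
split; rewrite eU.
  apply/integrableP; split => //.
  rewrite (integral_setU mu) //; last exact: measurableT_comp.
  apply: lte_add_pinfty; first by case/integrableP: fi.
  by case/integrableP: gi.
by rewrite (integral_setU mu) //= fv gv.
Qed.

Lemma hasint_continuous f a b : continuous f -> exists v, hasint f a b v.
Proof.
move=> cf; have fi : mu.-integrable `[a, b[%classic (EFin \o f).
  apply: (@integrableS _ _ _ mu `[a, b]%classic) => //.
    by apply: subset_itvl; rewrite bnd_simp.
  apply: continuous_compact_integrable; first exact: segment_compact.
  by apply: continuous_subspaceT => x; exact: cf.
exists (fine (\int[mu]_(x in `[a, b[%classic) (f x)%:E)%E); split => //.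
by rewrite fineK //; apply: integrable_fin_num fi.
Qed.

Lemma hasint_derive f F a b : a < b -> continuous f ->
  (forall x : R, is_derive x 1 F (f x)) -> hasint f a b (F b - F a).
Proof.
move=> ab cf dF; have [v [fi fv]] := hasint_continuous a b cf.
have cF : continuous F.
  by move=> x; apply: differentiable_continuous; apply/derivable1_diffP; have := dF x; move=> [].
split => //; rewrite integral_itv_bndo_bndc; last exact: measurable_int fi.
rewrite (@continuous_FTC2 _ f F)//; first by apply: continuous_subspaceT => x; exact: cf.
  split; first by move=> x _; have [] := dF x.
    by apply: cvg_at_right_filter; exact: cF.
  by apply: cvg_at_left_filter; exact: cF.
by move=> x _; rewrite derive1E; apply: derive_val.
Qed.

(** Measurability of [g] is derived rather than assumed: every subset of the finite exceptional set
    is countable, hence measurable, and off that set [g] agrees with an integrable function. Loop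
    weights are integrated in this way, without any control at coinciding times. *)
Lemma integral_off_seq (f : R -> R) (g : R -> \bar R) (s : seq R) a b v :
  hasint f a b v -> (forall x, a <= x < b -> x \notin s -> g x = (f x)%:E) ->
  (\int[mu]_(x in `[a, b[%classic) g x = v%:E)%E.
Proof.
move=> [fi <-] gf; set D : set (measurableTypeR R) := `[a, b[%classic; have mD : measurable D by exact: measurable_itv.
have mS (A : set (measurableTypeR R)) : (A `<=` [set` s])%classic -> measurable A.
  move=> As; have fA : finite_set A.
    apply: sub_finite_set As _; exact: finite_seq.
  exact: countable_measurable (finite_set_countable fA).
have mDS : measurable (D `\` [set` s])%classic by apply: measurableD => //; apply: mS.
have mIS : measurable (D `&` [set` s])%classic by apply: mS => x [].
have mg : measurable_fun D g.
  rewrite -(setUIDK D [set` s]); apply/measurable_funU => //; split.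
    by move=> _ Y mY; apply: mS => x [[_ ?] _].
  apply: (@eq_measurable_fun _ _ _ _ _ (EFin \o f)).
    move=> x; rewrite inE => -[]; rewrite /D /= in_itv /= => xD xs.
    by rewrite gf //; apply/negP.
  by apply: measurable_funS (measurable_int _ fi) => // x [].
apply: ae_eq_integral => //; first exact: measurable_int fi.
exists [set` s]%classic; split; first exact: mS.
  exact: (countable_lebesgue_measure0 (finite_set_countable (finite_seq s))).
move=> x /=; apply: contra_notP => xs; rewrite /D /= in_itv /= => xD.
by rewrite gf //; apply/negP.
Qed.

End HasInt.

(** * Exponential generating functions *)

Section ExponentialSeries.
Local Open Scope classical_set_scope.
Local Open Scope ring_scope.
Context {R : realType}.
Implicit Types (c : nat -> R) (t C : R).

Definition egf c t : R := limn (pseries (fun n => c n / n`!%:R) t).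

(** The ratio is fixed and the prefactor existential, so the class is stable under shifts, scalings
    and finite sums with the same [C]. *)
Definition geometric_bound C c := exists K : R, forall n, `|c n| <= K * C ^+ n.

Lemma geometric_bound_shift C c : 0 <= C ->
  geometric_bound C c -> geometric_bound C (fun n => c n.+1).
Proof. by move=> C0 [K h]; exists (K * C) => n; rewrite -mulrA -exprS. Qed.

Lemma geometric_bound_scale C k c :
  geometric_bound C c -> geometric_bound C (fun n => k * c n).
Proof.
move=> [K h]; exists (`|k| * K) => n.
by rewrite normrM -mulrA ler_wpM2l.
Qed.

Lemma geometric_bound_sum C (I : finType) (c : I -> nat -> R) :
  (forall i, geometric_bound C (c i)) ->
  geometric_bound C (fun n => \sum_i c i n).
Proof.
move=> /choice[K h]; exists (\sum_i K i) => n.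
rewrite mulr_suml; apply: le_trans (ler_norm_sum _ _ _) _.
by apply: ler_sum => i _; exact: h.
Qed.

Lemma egf_term_le C c K t n : (forall n, `|c n| <= K * C ^+ n) ->
  `|c n / n`!%:R * t ^+ n| <= K * exp_coeff (C * `|t|) n.
Proof.
move=> h; rewrite !normrM normfV normrX [`|n`!%:R|]ger0_norm ?ler0n//.
rewrite exp_coeffE exprMn [X in _ <= X](_ : _ = K * C ^+ n * (n`!%:R^-1 * `|t| ^+ n)); last first.
  by rewrite [in RHS]mulrA -!mulrA; congr (_ * _); rewrite mulrCA.
by rewrite -mulrA ler_wpM2r// mulr_ge0// ?invr_ge0 ?ler0n ?exprn_ge0.
Qed.

Lemma is_cvg_egf C c t : 0 <= C -> geometric_bound C c ->
  cvgn (pseries (fun n => c n / n`!%:R) t).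
Proof.
move=> C0 [K h]; apply: normed_cvg.
apply: (@series_le_cvg _ _ (fun n => K * exp_coeff (C * `|t|) n)).
- by move=> n /=.
- move=> n; rewrite (le_trans _ (egf_term_le t n h))//.
- by move=> n; exact: egf_term_le.
- rewrite (_ : (fun n => _) = K *: exp_coeff (C * `|t|))//.
  exact/is_cvg_seriesZ/is_cvg_series_exp_coeff.
Qed.

Lemma cvg_egf C c t : 0 <= C -> geometric_bound C c ->
  pseries (fun n => c n / n`!%:R) t @ \oo --> egf c t.
Proof. by move=> C0 h; exact: (is_cvg_egf (t := t) C0 h). Qed.

Lemma pseries_diffs_egf c :
  pseries_diffs (fun n => c n / n`!%:R) = (fun n => c n.+1 / n`!%:R).
Proof.
apply/funext => n; rewrite /pseries_diffs factS natrM invfM mulrCA.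
by congr (_ * _); rewrite mulrA mulfV ?mul1r ?pnatr_eq0.
Qed.

(** Formal differentiation shifts the coefficients of an exponential generating function.
    Differentiating term by term is allowed because the series and its first two formal derivatives
    converge at |t| + 1, a point beyond [t]. *)
Lemma egf_is_derive C c t : 0 <= C -> geometric_bound C c ->
  is_derive t 1 (egf c) (egf (fun n => c n.+1) t).
Proof.
move=> C0 h.
have h1 := geometric_bound_shift C0 h; have h2 := geometric_bound_shift C0 h1.
have := @pseries_snd_diffs R (fun n => c n / n`!%:R) (`|t| + 1) t.
rewrite !pseries_diffs_egf; apply.
- exact: is_cvg_egf C0 h.
- exact: is_cvg_egf C0 h1.
- exact: is_cvg_egf C0 h2.
- by rewrite [ltRHS]ger0_norm ?ltrDl ?addr_ge0.
Qed.

Lemma egf_continuous C c : 0 <= C -> geometric_bound C c -> continuous (egf c).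
Proof.
move=> C0 h t; apply: differentiable_continuous; apply/derivable1_diffP.
by have [] := egf_is_derive t C0 h.
Qed.

Lemma egf_at0 c : egf c 0 = c 0%N.
Proof.
apply: cvg_lim => //; rewrite -(cvg_shiftS _) /=.
apply: cvg_near_cst; apply: nearW => n.
rewrite /pseries /series /= big_nat_recl// big1 ?addr0; last first.
  by move=> i _; rewrite expr0n mulr0.
by rewrite expr0 mulr1 fact0 divr1.
Qed.

Lemma egf_scale C k c t : 0 <= C -> geometric_bound C c ->
  egf (fun n => k * c n) t = k * egf c t.
Proof.
move=> C0 h; apply: cvg_lim => //.
rewrite (_ : pseries _ t = (fun n => k * pseries (fun n => c n / n`!%:R) t n)); last first.
  apply/funext => n; rewrite /pseries /series /= mulr_sumr.
  by apply: eq_bigr => i _; rewrite !mulrA.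
apply: cvgMr; exact: cvg_egf C0 h.
Qed.

Lemma egf_sum C (I : finType) (c : I -> nat -> R) t : 0 <= C ->
  (forall i, geometric_bound C (c i)) ->
  egf (fun n => \sum_i c i n) t = \sum_i egf (c i) t.
Proof.
move=> C0 h; apply: cvg_lim => //.
rewrite (_ : pseries _ t = (fun n => \sum_i pseries (fun n => c i n / n`!%:R) t n)); last first.
  apply/funext => n; rewrite /pseries /series /= exchange_big /=.
  by apply: eq_bigr => i _; rewrite !mulr_suml.
apply: cvg_big => [|i _]; first exact: add_continuous.
exact: cvg_egf C0 (h i).
Qed.

Lemma egf_exp (a t : R) : egf (fun n => a ^+ n) t = expR (t * a).
Proof.
rewrite /egf /expR /pseries; congr (limn (series _)); apply/funext => n.
by rewrite /= exp_coeffE exprMn mulrAC mulrC [t ^+ n * _]mulrC.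
Qed.

(** Coefficients vanishing below [m] leave only a tail of the exponential series; this controls the
    remainder when the Dyson orders are summed. *)
Lemma egf_tail_le C (K : R) c m t : 0 <= C ->
  (forall n, (n < m)%N -> c n = 0) -> (forall n, `|c n| <= K * C ^+ n) ->
  `|egf c t| <= K * (expR (C * `|t|) - series (exp_coeff (C * `|t|)) m).
Proof.
move=> C0 c0 h; have gb : geometric_bound C c by exists K.
have cvl : `|pseries (fun n => c n / n`!%:R) t n| @[n --> \oo] --> `|egf c t|.
  apply: cvg_norm; exact: cvg_egf C0 gb.
have cvr : K * (series (exp_coeff (C * `|t|)) n - series (exp_coeff (C * `|t|)) m)
    @[n --> \oo] --> K * (expR (C * `|t|) - series (exp_coeff (C * `|t|)) m).
  apply: cvgMr; apply: cvgB; last exact: cvg_cst.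
  exact: (is_cvg_series_exp_coeff (C * `|t|)).
apply: ler_cvg_to cvl cvr _; near=> n.
have mn : (m <= n)%N by near: n; exists m.
rewrite /pseries sub_series_geq// /series /= [X in `|X|](big_cat_nat (leq0n m) mn)/=.
rewrite big1_seq ?add0r; last first.
  by move=> i; rewrite mem_index_iota => /andP[_ im]; rewrite c0// !mul0r.
apply: le_trans (ler_norm_sum _ _ _) _; rewrite mulr_sumr.
by apply: ler_sum => i _; exact: egf_term_le.
Unshelve. all: by end_near. Qed.

End ExponentialSeries.

(** * The Dyson series and its iterated integrals *)

Section DysonSeries.
Context {R : realType} (n : nat) (A Bs : 'M[R]_n).

(* [wcoef N k] is the coefficient of [x ^+ k] in [(A + x *: Bs) ^+ N]. *)
Fixpoint wcoef (N k : nat) : 'M[R]_n :=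
  match N with
  | 0 => (k == 0%N)%:R
  | N'.+1 => A *m wcoef N' k + (if k is k'.+1 then Bs *m wcoef N' k' else 0)
  end.

(** The definition peels off the first factor of the power; peeling off the last one gives a second
    recursion, needed to place the generators on the right in [ddysonE]. *)
Lemma wcoefSr N k : wcoef N.+1 k =
  wcoef N k *m A + (if k is k'.+1 then wcoef N k' *m Bs else 0).
Proof.
elim: N k => [|N IH] k.
  by case: k => [|[|k]] /=; rewrite ?mulr1 ?mul1r ?mulr0 ?mul0r ?mulmx1 ?mul1mx ?mulmx0 ?mul0mx.
have -> : wcoef N.+2 k = A *m wcoef N.+1 k + (if k is k'.+1 then Bs *m wcoef N.+1 k' else 0) by [].
case: k => [|k]; first by rewrite [in LHS]IH /= !addr0 mulmxA.
rewrite ![in LHS]IH /= !mulmxDr !mulmxDl !mulmxA -!addrA; congr (_ + _).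
rewrite addrCA; congr (_ + (_ + _)).
by case: k => [|k]; rewrite ?mulmx0 ?mul0mx// mulmxA.
Qed.

Lemma sum_wcoef N m : (N < m)%N -> \sum_(k < m) wcoef N k = (A + Bs) ^+ N.
Proof.
elim: N m => [|N IH] [|m] // Nm.
  by rewrite big_ord_recl /= big1 ?addr0.
rewrite exprS mulrDl -[X in A * X](IH m.+1) ?(ltnW Nm)// -(IH m Nm) /=.
rewrite big_split /= -mulmx_sumr; congr (_ + _).
by rewrite big_ord_recl add0r -mulmx_sumr.
Qed.

Lemma wcoef0r N : wcoef N 0 = A ^+ N.
Proof. by elim: N => [|N IH] //=; rewrite addr0 IH exprS. Qed.

Definition wbound : R := \sum_i \sum_j (`|A i j| + `|Bs i j|).

Lemma wbound_ge0 : 0 <= wbound.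
Proof. by rewrite !sumr_ge0// => i _; rewrite sumr_ge0// => j _; rewrite addr_ge0. Qed.

(** One more factor costs at most a row sum of |A| plus a row sum of |Bs|, whatever the order. The
    bound is therefore uniform in [k], as the summation over orders requires. *)
Lemma wcoef_le N k i j : `|wcoef N k i j| <= wbound ^+ N.
Proof.
elim: N k i j => [|N IH] k i j.
  rewrite /= expr0; case: (k == 0%N); rewrite !mxE ?normr0 ?ler01//.
  by case: (i == j); rewrite ?mulr1n ?mulr0n ?normr1 ?normr0.
have X0 := exprn_ge0 N wbound_ge0.
have le1 (X Y : 'M[R]_n) : (forall i j, `|Y i j| <= wbound ^+ N) ->
    `|(X *m Y) i j| <= (\sum_l `|X i l|) * wbound ^+ N.
  move=> hY; rewrite mxE mulr_suml; apply: le_trans (ler_norm_sum _ _ _) _.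
  by apply: ler_sum => l _; rewrite normrM ler_wpM2l.
rewrite /= exprS; apply: (@le_trans _ _ ((\sum_l (`|A i l| + `|Bs i l|)) * wbound ^+ N)).
  rewrite big_split /= mulrDl mxE; apply: le_trans (ler_normD _ _) _.
  apply: lerD; first by apply: le1 => i' j'; exact: IH.
  case: k => [|k]; last by apply: le1 => i' j'; exact: IH.
  by rewrite mxE normr0 mulr_ge0// sumr_ge0.
rewrite ler_wpM2r// /wbound [X in _ <= X](bigD1 i)//= lerDl sumr_ge0// => l _.
by rewrite sumr_ge0// => m _; rewrite addr_ge0.
Qed.

Lemma wcoef_bound k i j : geometric_bound wbound (fun N => wcoef N k i j).
Proof. by exists 1 => N; rewrite mul1r wcoef_le. Qed.

Definition dyson (k : nat) (t : R) : 'M[R]_n :=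
  \matrix_(i, j) egf (fun N => wcoef N k i j) t.

Lemma dyson_at0 k : dyson k 0 = (k == 0%N)%:R.
Proof. by apply/matrixP => i j; rewrite mxE egf_at0. Qed.

Lemma dyson_continuous k i j : continuous (fun t => dyson k t i j).
Proof.
have := egf_continuous wbound_ge0 (wcoef_bound k i j).
by under [in X in _ -> X]eq_fun do rewrite mxE.
Qed.

Lemma egf_add C (c c' : nat -> R) t : 0 <= C -> geometric_bound C c ->
  geometric_bound C c' -> egf (fun n => c n + c' n) t = egf c t + egf c' t.
Proof.
move=> C0 h h'; have := egf_sum (I := bool) (c := fun b => if b then c else c') t C0.
rewrite big_bool /= => <-; last by case.
by congr (egf _ t); apply/funext => m; rewrite big_bool.
Qed.

Lemma egf_mulmxl k (X : 'M[R]_n) i j t :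
  egf (fun N => (X *m wcoef N k) i j) t = (X *m dyson k t) i j.
Proof.
rewrite mxE; under [in LHS]eq_fun do rewrite mxE.
rewrite (egf_sum _ wbound_ge0) => [|l]; last exact/geometric_bound_scale/wcoef_bound.
apply: eq_bigr => l _; rewrite mxE (egf_scale _ _ wbound_ge0)//.
exact: wcoef_bound.
Qed.

Lemma egf_mulmxr k (X : 'M[R]_n) i j t :
  egf (fun N => (wcoef N k *m X) i j) t = (dyson k t *m X) i j.
Proof.
rewrite mxE; under [in LHS]eq_fun do rewrite mxE.
under [in LHS]eq_fun do under eq_bigr do rewrite mulrC.
rewrite (egf_sum _ wbound_ge0) => [|l]; last exact/geometric_bound_scale/wcoef_bound.
apply: eq_bigr => l _; rewrite mxE (egf_scale _ _ wbound_ge0) 1?mulrC//.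
exact: wcoef_bound.
Qed.

Lemma mulmxl_bound k (X : 'M[R]_n) i j :
  geometric_bound wbound (fun N => (X *m wcoef N k) i j).
Proof.
under eq_fun do rewrite mxE; apply: geometric_bound_sum => l.
exact/geometric_bound_scale/wcoef_bound.
Qed.

Lemma mulmxr_bound k (X : 'M[R]_n) i j :
  geometric_bound wbound (fun N => (wcoef N k *m X) i j).
Proof.
under eq_fun do rewrite mxE; apply: geometric_bound_sum => l.
under eq_fun do rewrite mulrC; exact/geometric_bound_scale/wcoef_bound.
Qed.

Definition ddyson (k : nat) (t : R) : 'M[R]_n :=
  A *m dyson k t + (if k is k'.+1 then Bs *m dyson k' t else 0).

(** Both sides are the generating function of the shifted coefficients [wcoef N.+1 k], expanded at
    one end of the product or at the other. *)
Lemma ddysonE k t :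
  ddyson k t = dyson k t *m A + (if k is k'.+1 then dyson k' t *m Bs else 0).
Proof.
apply/matrixP => i j.
transitivity (egf (fun N => wcoef N.+1 k i j) t); first symmetry.
  rewrite /ddyson mxE -egf_mulmxl; case: k => [|k].
    rewrite [X in _ + X]mxE addr0; congr (egf _ t); apply/funext => N.
    by rewrite /= addr0.
  rewrite -egf_mulmxl -(egf_add _ wbound_ge0); [|exact: mulmxl_bound..].
  by congr (egf _ t); apply/funext => N; rewrite /= mxE.
under [in LHS]eq_fun do rewrite wcoefSr.
rewrite mxE -egf_mulmxr; case: k => [|k].
  rewrite [X in _ + X]mxE addr0; congr (egf _ t); apply/funext => N.
  by rewrite addr0.
rewrite -egf_mulmxr -(egf_add _ wbound_ge0); [|exact: mulmxr_bound..].
by congr (egf _ t); apply/funext => N; rewrite mxE.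
Qed.

Lemma dyson_is_derive k i j (t : R) :
  is_derive t 1 (fun t => dyson k t i j) (ddyson k t i j).
Proof.
have -> : (fun t => dyson k t i j) = egf (fun N => wcoef N k i j).
  by apply/funext => s; rewrite mxE.
apply: is_derive_eq; first exact: egf_is_derive wbound_ge0 (wcoef_bound k i j).
rewrite /ddyson mxE -egf_mulmxl; case: k => [|k].
  rewrite [X in _ + X]mxE addr0; congr (egf _ t); apply/funext => N.
  by rewrite /= addr0.
rewrite -egf_mulmxl -(egf_add _ wbound_ge0); [|exact: mulmxl_bound..].
by congr (egf _ t); apply/funext => N; rewrite /= mxE.
Qed.

End DysonSeries.

(** * Duhamel's formula at each order *)

Section DysonIntegral.
Context {R : realType} (n : nat) (A : 'M[R]_n) (K : finType) (w : K -> R)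
  (B : K -> 'M[R]_n).

Let Bs := \sum_k w k *: B k.
Notation E := (dyson A Bs).
Notation dE := (ddyson A Bs).

Definition hasintmx (F : R -> 'M[R]_n) a b (V : 'M[R]_n) :=
  forall i j, hasint (fun s => F s i j) a b (V i j).

Lemma hasintmx_unique F a b V V' : hasintmx F a b V -> hasintmx F a b V' -> V = V'.
Proof. by move=> h h'; apply/matrixP => i j; apply: hasint_unique (h i j) (h' i j). Qed.

Lemma hasintmx_ext F G a b V : (forall x, a <= x < b -> F x = G x) ->
  hasintmx F a b V -> hasintmx G a b V.
Proof. by move=> FG h i j; apply: hasint_ext (h i j) => x xab; rewrite FG. Qed.

Lemma hasintmx_sum (I : Type) (s : seq I) (P : pred I) (F : I -> R -> 'M[R]_n) a b V :
  (forall i, hasintmx (F i) a b (V i)) ->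
  hasintmx (fun x => \sum_(i <- s | P i) F i x) a b (\sum_(i <- s | P i) V i).
Proof.
move=> h i j; rewrite summxE; under [X in hasint X]funext do rewrite summxE.
by apply: hasint_sum => l; exact: h.
Qed.

Lemma hasintmx_scale F a b V k : hasintmx F a b V ->
  hasintmx (fun x => k *: F x) a b (k *: V).
Proof.
move=> h i j; rewrite mxE; under [X in hasint X]funext do rewrite mxE.
exact: hasint_scale.
Qed.

Lemma hasintmx_mull F a b V (X : 'M[R]_n) : hasintmx F a b V ->
  hasintmx (fun x => X *m F x) a b (X *m V).
Proof.
move=> h i j; rewrite mxE; under [X in hasint X]funext do rewrite mxE.
by apply: hasint_sum => l; apply: hasint_scale.
Qed.

Lemma hasintmx_mulr F a b V (X : 'M[R]_n) : hasintmx F a b V ->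
  hasintmx (fun x => F x *m X) a b (V *m X).
Proof.
move=> h i j; rewrite mxE; under [X in hasint X]funext do rewrite mxE.
apply: hasint_sum => l; rewrite mulrC; under [X in hasint X]funext do rewrite mulrC.
exact: hasint_scale.
Qed.

Lemma hasintmx_cat F a b c V W : a <= b -> b <= c ->
  hasintmx F a b V -> hasintmx F b c W -> hasintmx F a c (V + W).
Proof. by move=> ab bc h h' i j; rewrite mxE; apply: hasint_cat (h i j) (h' i j). Qed.

(** The part of order [k] in x of exp((b - s)(A + x Bs)) X exp((s - a)(A + x Bs)): [X] is inserted
    at time [s] and [k] integrated insertions are shared between the two sides. *)
Definition duhamel (X : 'M[R]_n) (k : nat) (a b s : R) : 'M[R]_n :=
  \sum_(i < k.+1) E i (b - s) *m X *m E (k - i) (s - a).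

Lemma continuous_subl (f : R -> R) c : continuous f -> continuous (fun s => f (c - s)).
Proof.
move=> cf s; apply: (@continuous_comp _ _ _ (fun s => c - s) f); last exact: cf.
by apply: cvgB; [exact: cvg_cst|exact: cvg_id].
Qed.

Lemma continuous_subr (f : R -> R) c : continuous f -> continuous (fun s => f (s - c)).
Proof.
move=> cf s; apply: (@continuous_comp _ _ _ (fun s => s - c) f); last exact: cf.
by apply: cvgB; [exact: cvg_id|exact: cvg_cst].
Qed.

Lemma duhamel_continuous X k (a b : R) i j : continuous (fun s => duhamel X k a b s i j).
Proof.
have -> : (fun s => duhamel X k a b s i j) = fun s => \sum_(l < k.+1) \sum_m \sum_p
    E l (b - s) i p * X p m * E (k - l) (s - a) m j.
  apply/funext => s; rewrite summxE; apply: eq_bigr => l _; rewrite mxE.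
  by apply: eq_bigr => m _; rewrite mxE mulr_suml.
move=> s; apply: cvg_big => [|l _]; first exact: add_continuous.
apply: cvg_big => [|m _]; first exact: add_continuous.
apply: cvg_big => [|p _]; first exact: add_continuous.
have c1 := continuous_subl (c := b) (@dyson_continuous _ _ A Bs l i p).
have c2 := continuous_subr (c := a) (@dyson_continuous _ _ A Bs (k - l) m j).
exact: (cvgM (cvgM (c1 s) (cvg_cst (X p m))) (c2 s)).
Qed.

Lemma is_derive_subl (f df : R -> R) (c s : R) : (forall t : R, is_derive t 1 f (df t)) ->
  is_derive s 1 (fun s => f (c - s)) (- df (c - s)).
Proof.
move=> h; have h1 : is_derive s 1 (fun s => c - s) (-1).
  have := is_deriveB (is_derive_cst c s 1) (is_derive_id s (1 : R)).
  by rewrite sub0r.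
have := @is_derive1_comp R f (fun s => c - s) s _ _ (h (c - s)) h1.
by rewrite mulrN1.
Qed.

Lemma is_derive_subr (f df : R -> R) (c s : R) : (forall t : R, is_derive t 1 f (df t)) ->
  is_derive s 1 (fun s => f (s - c)) (df (s - c)).
Proof.
move=> h; have h1 : is_derive s 1 (fun s => s - c) 1.
  have := is_deriveB (is_derive_id s (1 : R)) (is_derive_cst c s 1).
  by rewrite subr0.
have := @is_derive1_comp R f (fun s => s - c) s _ _ (h (s - c)) h1.
by rewrite mulr1.
Qed.

(* Differentiating [sum_i (k.+1 - i) E_i(b - s) E_(k.+1-i)(s - a)] telescopes to the
   Duhamel integrand, since E' = A E_i + Bs E_(i-1) = E_i A + E_(i-1) Bs. *)
Lemma duhamel_hasint k (a b : R) : a < b ->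
  hasintmx (duhamel Bs k a b) a b (k.+1%:R *: E k.+1 (b - a)).
Proof.
move=> ab.
pose P s := \sum_(i < k.+2) (k.+1 - i)%:R *: (E i (b - s) *m E (k.+1 - i) (s - a)).
(* Since E_i(0) = 0 for i > 0, only i = 0 survives at s = b, with weight k + 1, and only i = k + 1
   at s = a, with weight 0. *)
have -> : k.+1%:R *: E k.+1 (b - a) = P b - P a.
  rewrite /P !subrr [X in _ = X - _]big_ord_recl [X in _ = _ - X]big_ord_recr /=.
  rewrite subnn scale0r addr0 dyson_at0 mul1mx subn0 !big1 ?addr0 ?subr0//.
    by move=> i _; rewrite dyson_at0 subn_eq0 leqNgt ltn_ord mulmx0 scaler0.
  by move=> i _; rewrite dyson_at0 mul0mx scaler0.
have dP s : \sum_(i < k.+2) (k.+1 - i)%:R *: (E i (b - s) *m dE (k.+1 - i) (s - a)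
      - dE i (b - s) *m E (k.+1 - i) (s - a)) = duhamel Bs k a b s.
  pose G i j := E i (b - s) *m Bs *m E j (s - a).
  transitivity (\sum_(i < k.+1) (k.+1 - i)%:R *: G i (k - i)%N
       - \sum_(i < k.+1) (k - i)%:R *: G i (k - i)%N).
    rewrite [LHS](eq_bigr (fun i : 'I_k.+2 => (k.+1 - i)%:R *:
      ((if (k.+1 - i)%N is j.+1 then G i j else 0)
       - (if (i : nat) is i'.+1 then G i' (k.+1 - i)%N else 0)))); last first.
      move=> i _; congr (_ *: _); rewrite [dE i _]ddysonE /ddyson.
      rewrite mulmxDr mulmxDl mulmxA opprD addrACA subrr add0r.
      congr (_ - _); last by case: (i : nat) => [|i']; rewrite ?mul0mx.
      by case: (k.+1 - i)%N => [|j]; rewrite ?mulmx0// mulmxA.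
    under eq_bigr do rewrite scalerBr; rewrite sumrB; congr (_ - _).
      rewrite big_ord_recr /= subnn scale0r addr0; apply: eq_bigr => i _.
      by rewrite subSn// -ltnS ltn_ord.
    by rewrite big_ord_recl /= scaler0 add0r; apply: eq_bigr => i _; rewrite /bump /= add1n subSS.
  rewrite -sumrB; apply: eq_bigr => i _; rewrite -scalerBl -natrB ?leq_sub2r//.
  by rewrite subSn ?subSnn ?scale1r// -ltnS ltn_ord.
move=> i j; rewrite mxE [X in _ + X]mxE; apply: (@hasint_derive _ _ (fun t => P t i j)) => //.
  exact: duhamel_continuous.
move=> s; rewrite -dP.
have -> : (fun t => P t i j) = \sum_(l < k.+2) \sum_m (fun t => (k.+1 - l)%:R *
    (E l (b - t) i m * E (k.+1 - l) (t - a) m j)).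
  apply/funext => t; rewrite /P summxE fct_sumE; apply: eq_bigr => l _.
  by rewrite !mxE fct_sumE mulr_sumr.
rewrite summxE; apply: is_derive_sum => l.
rewrite !mxE -sumrB mulr_sumr; apply: is_derive_sum => m.
apply: is_derive_eq.
  apply: is_deriveM; apply: is_deriveM.
    exact: (is_derive_subl b s (dyson_is_derive A Bs l i m)).
  exact: (is_derive_subr a s (dyson_is_derive A Bs _ m j)).
rewrite /GRing.scale /= !mulr0 addr0 mulrN. congr (_ * (_ - _)); by rewrite mulrC.
Qed.

End DysonIntegral.

(** * Time-ordered products with integrated insertions *)

Section OrderedProducts.
Context {R : realType} (n : nat) (A : 'M[R]_n) (K : finType) (w : K -> R)
  (B : K -> 'M[R]_n).

Let Bs := \sum_k w k *: B k.
Notation E := (dyson A Bs).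

(* Lists of insertions are kept by decreasing time: [wprod l k t] is the time-ordered
   product on [[0, t]] with the insertions of [l] and [k] further, integrated ones. *)
Fixpoint wprod (l : seq (K * R)) (k : nat) (t : R) : 'M[R]_n :=
  match l with
  | [::] => E k t
  | (b, tau) :: l' =>
      \sum_(i < k.+1) E i (t - tau) *m B b *m wprod l' (k - i) tau
  end.

Fixpoint insert_time (x : K * R) (l : seq (K * R)) :=
  match l with
  | [::] => [:: x]
  | y :: l' => if y.2 <= x.2 then x :: l else y :: insert_time x l'
  end.

Fixpoint dec_times (t : R) (l : seq (K * R)) : bool :=
  match l with
  | [::] => true
  | y :: l' => [&& 0 < y.2, y.2 < t & dec_times y.2 l']
  end.

Lemma triangle_sum (V : nmodType) (G : nat -> nat -> V) k :
  \sum_(i < k.+1) \sum_(j < (k - i).+1) G i j =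
  \sum_(m < k.+1) \sum_(i < m.+1) G i (m - i)%N.
Proof.
elim: k => [|k IH]; first by rewrite !big_ord1.
rewrite [RHS]big_ord_recr /= -IH [LHS]big_ord_recr /= subnn big_ord1.
rewrite [X in _ = _ + X]big_ord_recr /= subnn addrA; congr (_ + _).
rewrite -big_split /=; apply: eq_bigr => i _.
by rewrite subSn; [rewrite big_ord_recr|rewrite -ltnS].
Qed.

(** A Leibniz rule: integrating a new insertion over all positions acts on one factor of the ordered
    product at a time and multiplies by the order of that factor; the orders add up to k + 1. Only
    the weighted sum over [b] has a closed form, so the separate integrals are existential. *)
Lemma wprod_hasint l k (t : R) : 0 < t -> dec_times t l ->
  exists2 V : K -> 'M[R]_n,
    forall b, hasintmx (fun s => wprod (insert_time (b, s) l) k t) 0 t (V b)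
  & \sum_b w b *: V b = k.+1%:R *: wprod l k.+1 t.
Proof.
have duh m (c e : R) : c < e -> exists2 V : K -> 'M[R]_n,
    forall b, hasintmx (duhamel A w B (B b) m c e) c e (V b)
  & \sum_b w b *: V b = m.+1%:R *: E m.+1 (e - c).
  move=> ce; have h (b : K) (i j : 'I_n) : exists v,
      hasint (fun s => duhamel A w B (B b) m c e s i j) c e v.
    by apply: hasint_continuous; exact: duhamel_continuous.
  have [V hV] := choice (fun x : K * 'I_n * 'I_n => h x.1.1 x.1.2 x.2).
  pose W b := \matrix_(i, j) V (b, i, j).
  have hW b : hasintmx (duhamel A w B (B b) m c e) c e (W b).
    by move=> i j; rewrite mxE; exact: hV (b, i, j).
  exists W => //; apply: hasintmx_unique (duhamel_hasint A w B m ce).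
  apply: hasintmx_ext (hasintmx_sum _ _ (fun b => hasintmx_scale (w b) (hW b))) => s _.
  under eq_bigr do rewrite scaler_sumr; rewrite exchange_big /=; apply: eq_bigr => i _.
  rewrite mulmx_sumr mulmx_suml; apply: eq_bigr => b _.
  by rewrite -scalemxAr -scalemxAl.
elim: l k t => [|[b1 tau] l IH] k t t0 /=.
  move=> _; have [V hV eV] := duh k 0 t t0; exists V; last by rewrite eV subr0.
  by move=> b; apply: hasintmx_ext (hV b) => s _; apply: eq_bigr => i _; rewrite subr0.
move=> /and3P[tau0 taut dl].
have hk m : exists V : K -> 'M[R]_n,
    (forall b, hasintmx (fun s => wprod (insert_time (b, s) l) m tau) 0 tau (V b))
  /\ \sum_b w b *: V b = m.+1%:R *: wprod l m.+1 tau.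
  by have [V ? ?] := IH m tau tau0 dl; exists V.
have [V1 hV1] := choice hk.
have hd m : exists V : K -> 'M[R]_n,
    (forall b, hasintmx (duhamel A w B (B b) m tau t) tau t (V b))
  /\ \sum_b w b *: V b = m.+1%:R *: E m.+1 (t - tau).
  by have [V ? ?] := duh m tau t taut; exists V.
have [V2 hV2] := choice hd.
(* The first sum collects new times below [tau], where the induction hypothesis treats the tail, and
   the second those above, where Duhamel's formula applies on [tau, t]. *)
exists (fun b => \sum_(i < k.+1) E i (t - tau) *m B b1 *m V1 (k - i)%N b +
                 \sum_(m < k.+1) V2 m b *m (B b1 *m wprod l (k - m) tau)).
  move=> b; apply: hasintmx_cat (ltW tau0) (ltW taut) _ _.
    apply: (@hasintmx_ext _ _ (fun s => \sum_(i < k.+1) E i (t - tau) *m B b1 *m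
        wprod (insert_time (b, s) l) (k - i) tau)).
      by move=> s /andP[_ st]; rewrite leNgt st.
    apply: hasintmx_sum => i; apply: hasintmx_mull; exact: (hV1 (k - i)%N).1.
  apply: (@hasintmx_ext _ _ (fun s => \sum_(m < k.+1) duhamel A w B (B b) m tau t s *m
      (B b1 *m wprod l (k - m) tau))).
    move=> s /andP[ts _]; rewrite ts /=.
    pose G i j := E i (t - s) *m B b *m E j (s - tau) *m (B b1 *m wprod l (k - (i + j)) tau).
    transitivity (\sum_(m < k.+1) \sum_(i < m.+1) G i (m - i)%N).
      apply: eq_bigr => m _; rewrite mulmx_suml; apply: eq_bigr => i _.
      by rewrite /G subnKC// -ltnS ltn_ord.
    rewrite -triangle_sum; apply: eq_bigr => i _; rewrite mulmx_sumr.
    by apply: eq_bigr => j _; rewrite /G !mulmxA subnDA.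
  apply: hasintmx_sum => m; apply: hasintmx_mulr; exact: (hV2 m).1.
rewrite (eq_bigr (fun b => \sum_(i < k.+1) E i (t - tau) *m B b1 *m (w b *: V1 (k - i)%N b) +
   \sum_(m < k.+1) (w b *: V2 m b) *m (B b1 *m wprod l (k - m) tau))); last first.
  move=> b _; rewrite scalerDr !scaler_sumr; congr (_ + _); apply: eq_bigr => i _.
    by rewrite scalemxAr.
  by rewrite scalemxAl.
rewrite big_split /= exchange_big /= [X in _ + X]exchange_big /=.
under eq_bigr do rewrite -mulmx_sumr (hV1 _).2.
under [X in _ + X]eq_bigr do rewrite -mulmx_suml (hV2 _).2.
pose T i := E i (t - tau) *m B b1 *m wprod l (k.+1 - i) tau.
(* The lower part multiplies [T i] by its order k + 1 - i, the upper part by its order i. *)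
transitivity (\sum_(i < k.+2) (k.+1 - i)%:R *: T i + \sum_(i < k.+2) (i : nat)%:R *: T i).
  congr (_ + _).
    rewrite [RHS]big_ord_recr /= subnn scale0r addr0; apply: eq_bigr => i _.
    by rewrite -scalemxAr /T subSn// -ltnS ltn_ord.
  rewrite [RHS]big_ord_recl scale0r add0r; apply: eq_bigr => i _.
  by rewrite /T lift0 subSS -scalemxAl mulmxA.
rewrite -big_split /= scaler_sumr; apply: eq_bigr => i _.
by rewrite -scalerDl -natrD subnK// -ltnS ltn_ord.
Qed.

Definition sort_times := foldl (fun l x => insert_time x l).

Lemma insert_time_dec t l x : 0 < x.2 < t -> x.2 \notin map snd l ->
  dec_times t l -> dec_times t (insert_time x l).
Proof.
elim: l t => [|y l IH] t /= /andP[x0 xt]; first by rewrite x0 xt.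
rewrite inE negb_or => /andP[xy xl] /and3P[y0 yt dl].
have [yx|xy'] := leP y.2 x.2; first by rewrite /= x0 xt y0 lt_neqAle eq_sym xy yx.
by rewrite /= y0 yt IH// x0.
Qed.

Lemma perm_insert_time l x : perm_eq (insert_time x l) (x :: l).
Proof.
elim: l => [|y l IH] //=; case: ifP => // _.
apply: (@perm_trans _ (y :: x :: l)); first by rewrite perm_cons.
exact: (permEl (perm_catCA [:: y] [:: x] l)).
Qed.

Lemma perm_cat_insert_time s l x : perm_eq (s ++ insert_time x l) (x :: s ++ l).
Proof.
apply: (@perm_trans _ (s ++ x :: l)); first by rewrite perm_cat2l perm_insert_time.
exact: (permEl (perm_catCA s [:: x] l)).
Qed.

Lemma perm_sort_times s l : perm_eq (sort_times l s) (s ++ l).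
Proof.
elim: s l => [|x s IH] l //=; apply: perm_trans (IH _) _.
exact: perm_cat_insert_time.
Qed.

(** Time 0 is excluded along with coincidences, because the trace closes and the observable acts
    there. *)
Definition good_times (t : R) (s : seq (K * R)) :=
  uniq (map snd s) && all (fun x => 0 < x.2 < t) s.

Lemma sort_times_dec t s l : good_times t (s ++ l) -> dec_times t l ->
  dec_times t (sort_times l s).
Proof.
elim: s l => [|x s IH] l //= /andP[/= /andP[xs us] /andP[xt al]] dl; apply: IH.
  have pe : perm_eq (s ++ insert_time x l) (x :: s ++ l).
    exact: perm_cat_insert_time.
  rewrite /good_times (perm_uniq (perm_map snd pe)) (perm_all _ pe) /= xs us.
  by rewrite xt.
apply: insert_time_dec => //; apply: contra xs.
by rewrite map_cat mem_cat => ->; rewrite orbT.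
Qed.

End OrderedProducts.

(** * Iterated Poisson integrals of ordered products *)

Section PoissonIntegral.
Context {R : realType} (n : nat) (A : 'M[R]_n) (E : finType) (beta u : R)
  (B : E * bool -> 'M[R]_n) (X : 'M[R]_n).

Let w (b : E * bool) : R := if b.2 then u else 1 - u.

(** The list [l] holds the insertions already fixed by the outer integrals, so the induction runs
    over all [l]. The factors of [wprod_hasint] accumulate to k!. *)
Lemma ppint_wprod k l (F : seq (E * bool * R) -> \bar R) :
  0 < beta -> dec_times beta l -> good_times beta l ->
  (forall s, size s = k -> good_times beta (s ++ l) ->
     F s = (\tr (X *m wprod A w B (sort_times l s) 0 beta))%:E) ->
  ppint beta u k F = (k`!%:R * \tr (X *m wprod A w B l k beta))%:E.
Proof.
move=> b0; elim: k l F => [|k IH] l F dl gl hF.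
  by rewrite /= hF// fact0 mul1r.
have [V hV eV] := wprod_hasint A w B k b0 dl.
rewrite /=.
have step b : (\int[@lebesgue_measure R]_(t in `[0%R, beta[%classic)
      ppint beta u k (fun s => F ((b, t) :: s)) = (k`!%:R * \tr (X *m V b))%:E)%E.
  (* The exceptional times are 0 and those already chosen. *)
  apply: (@integral_off_seq _ (fun t => k`!%:R * \tr (X *m wprod A w B (insert_time (b, t) l) k beta))
     _ (0 :: map snd l)).
    apply: hasint_scale; rewrite /mxtrace.
    apply: hasint_sum => i.
    exact: (hasintmx_mull X (hV b) i i).
  move=> t /andP[t0 tb]; rewrite inE negb_or => /andP[tn0 tl].
  have tp : 0 < t by rewrite lt_neqAle eq_sym tn0.
  have pe : perm_eq (insert_time (b, t) l) ((b, t) :: l) by exact: perm_insert_time.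
  have pe2 s : perm_eq (s ++ insert_time (b, t) l) (((b, t) :: s) ++ l).
    exact: perm_cat_insert_time.
  have gp (s1 s2 : seq (E * bool * R)) : perm_eq s1 s2 -> good_times beta s1 = good_times beta s2.
    by move=> p; rewrite /good_times (perm_uniq (perm_map snd p)) (perm_all _ p).
  apply: IH.
  - by apply: insert_time_dec => //=; rewrite ?tp.
  - rewrite (gp _ _ pe) /good_times /= tl tp tb /=; exact: gl.
  - move=> s ss; rewrite (gp _ _ (pe2 s)) => gs.
    by rewrite hF //= ss.
under eq_bigr do rewrite step -EFinM.
rewrite sumEFin; congr (_%:E).
under eq_bigr do rewrite mulrCA.
rewrite -mulr_sumr factS natrM [k.+1%:R * _]mulrC -mulrA; congr (_ * _).
rewrite -mxtraceZ scalemxAr -eV mulmx_sumr raddf_sum; apply: eq_bigr => b _ /=.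
by rewrite -scalemxAr mxtraceZ.
Qed.

End PoissonIntegral.

(** * Summation of the Dyson orders *)

Section DysonSum.
Local Open Scope classical_set_scope.
Local Open Scope ring_scope.
Context {R : realType} (n : nat) (A Bs : 'M[R]_n).

Lemma expmx_egf (Y : 'M[R]_n) t i j :
  expmx (t *: Y) i j = egf (fun N => (Y ^+ N) i j) t.
Proof.
rewrite mxE /egf /pseries; congr (limn _); apply/funext => m.
rewrite /series /= big_mkord; apply: eq_bigr => k _.
have -> : (t *: Y) ^+ k = t ^+ k *: Y ^+ k.
  elim: (k : nat) => [|q IH]; first by rewrite !expr0 scale1r.
  rewrite !exprS IH -[LHS]/((t *: Y) *m (t ^+ q *: Y ^+ q)).
  by rewrite -scalemxAl -scalemxAr scalerA.
by rewrite mxE -mulrA mulrC.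
Qed.

Lemma cvg_sum_dyson t i j :
  \sum_(k < m) dyson A Bs k t i j @[m --> \oo] --> expmx (t *: (A + Bs)) i j.
Proof.
(* The factor 2 absorbs the number of orders: a power N has at most N + 1 <= 2^N of them, each
   bounded by [wbound] to the power N. *)
rewrite expmx_egf; set C := 2 * wbound A Bs.
have W0 := wbound_ge0 A Bs; have C0 : 0 <= C by rewrite mulr_ge0.
have bk k : geometric_bound C (fun N => wcoef A Bs N k i j).
  exists 1 => N; rewrite mul1r (le_trans (wcoef_le A Bs N k i j))//.
  by apply: lerXn2r; rewrite ?nnegrE// /C ler_peMl// ler1n.
(* The part of the N-th power of order at least [m] in [Bs]; it vanishes for N < m, so its
   generating function is an exponential tail. *)
pose c m N := ((A + Bs) ^+ N - \sum_(k < m) wcoef A Bs N k) i j.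
have cE m N : c m N = \sum_(m <= k < N.+1) wcoef A Bs N k i j.
  rewrite /c -(@sum_wcoef _ _ _ _ N (maxn m N.+1)) ?leq_max ?leqnn ?orbT//.
  rewrite -!(big_mkord xpredT (wcoef A Bs N)).
  rewrite (big_cat_nat (leq0n m) (leq_maxl _ _)) /= addrAC subrr add0r summxE.
  have [mN|Nm] := leqP m N; last by rewrite (maxn_idPl _)// !big_geq.
  by rewrite (maxn_idPr _)// leqW.
have cb m N : `|c m N| <= 1 * C ^+ N.
  rewrite cE mul1r; apply: le_trans (ler_norm_sum _ _ _) _.
  apply: le_trans (ler_sum _ (fun k _ => wcoef_le A Bs N k i j)) _.
  rewrite sumr_const_nat /C exprMn -[X in X <= _]mulr_natl ler_wpM2r ?exprn_ge0// -natrX ler_nat.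
  by rewrite (leq_trans (leq_subr _ _))// ltn_expl.
have eE m : egf (fun N => ((A + Bs) ^+ N) i j) t - \sum_(k < m) dyson A Bs k t i j = egf (c m) t.
  have bf : geometric_bound C (fun N => ((A + Bs) ^+ N) i j).
    exists 1 => N; have := cb 0%N N; congr (`|_| <= _).
    by rewrite /c big_ord0 subr0.
  under eq_bigr do rewrite mxE.
  have -> : c m = fun N => ((A + Bs) ^+ N) i j + -1 * \sum_(k < m) wcoef A Bs N k i j.
    by apply/funext => N; rewrite /c !mxE summxE mulN1r.
  have bs := geometric_bound_sum (fun k : 'I_m => bk k).
  rewrite (egf_add _ C0)//; last exact: geometric_bound_scale.
  by rewrite (egf_scale _ _ C0)// (egf_sum _ C0)// mulN1r.
pose L := egf (fun N => ((A + Bs) ^+ N) i j) t.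
have -> : (fun m => \sum_(k < m) dyson A Bs k t i j) = (fun m => L - egf (c m) t).
  by apply/funext => m; rewrite -eE opprB addrC subrK.
rewrite -[X in _ --> X]subr0; apply: cvgB; first exact: cvg_cst.
apply/norm_cvg0P; apply: (@squeeze_cvgr _ _ _ _ (fun=> 0)
   (fun m => expR (C * `|t|) - series (exp_coeff (C * `|t|)) m)).
- near=> m; rewrite normr_ge0 /= -[leRHS]mul1r.
  apply: egf_tail_le => // N Nm; rewrite cE big_geq//.
- exact: cvg_cst.
rewrite -(subrr (expR (C * `|t|))); apply: cvgB; first exact: cvg_cst.
exact: (is_cvg_series_exp_coeff (C * `|t|)).
Unshelve. all: by end_near. Qed.

Lemma cvg_trace_sum_dyson (X : 'M[R]_n) t :
  \sum_(0 <= k < m) \tr (X *m dyson A Bs k t) @[m --> \oo] -->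
  \tr (X *m expmx (t *: (A + Bs))).
Proof.
have -> : (fun m => \sum_(0 <= k < m) \tr (X *m dyson A Bs k t)) =
   (fun m => \sum_i \sum_j X i j * \sum_(k < m) dyson A Bs k t j i).
  apply/funext => m; rewrite big_mkord exchange_big /=; apply: eq_bigr => i _.
  under eq_bigr do rewrite mxE; rewrite exchange_big; apply: eq_bigr => j _.
  by rewrite mulr_sumr.
rewrite /mxtrace; apply: cvg_big => [|i _]; first exact: add_continuous.
rewrite mxE; apply: cvg_big => [|j _]; first exact: add_continuous.
by apply: cvgMr; exact: cvg_sum_dyson.
Qed.

End DysonSum.

(** The factorial of the iterated integral cancels that of the Poisson law, which leaves the plain
    sum of all Dyson orders. *)
Lemma rho_int_trace {R : realType} (n : nat) (A : 'M[R]_n) (E : finType) (beta u : R)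
    (B : E * bool -> 'M[R]_n) (X : 'M[R]_n) (G : seq (E * bool * R) -> \bar R) :
  let w := fun b : E * bool => if b.2 then u else 1 - u in
  0 < beta ->
  (forall s, good_times beta s ->
     G s = (\tr (X *m wprod A w B (sort_times [::] s) 0 beta))%:E) ->
  rho_int beta u G =
  (expR (- beta * #|{: E}|%:R) * \tr (X *m expmx (beta *: (A + \sum_b w b *: B b))))%:E.
Proof.
move=> w b0 hG; set e := expR _; rewrite /rho_int.
have pE m : ppint beta u m G = (m`!%:R * \tr (X *m dyson A (\sum_b w b *: B b) m beta))%:E.
  apply: (ppint_wprod (l := [::])) => // s _; rewrite cats0; exact: hG.
apply: cvg_lim => //.
have -> : (fun m => \sum_(0 <= k < m) ((e / k`!%:R)%:E * ppint beta u k G)%E) =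
   EFin \o (fun m => e * \sum_(0 <= k < m) \tr (X *m dyson A (\sum_b w b *: B b) k beta)).
  apply/funext => m /=; rewrite mulr_sumr -sumEFin; apply: eq_bigr => k _.
  by rewrite pE -EFinM mulrA divfK// pnatr_eq0 -lt0n fact_gt0.
apply: cvg_EFin; first exact: nearW.
apply: cvgMr; exact: cvg_trace_sum_dyson.
Qed.

Lemma dyson0_diag {R : realType} (n : nat) (d : 'rV[R]_n) (Bs : 'M[R]_n) t :
  dyson (diag_mx d) Bs 0 t = diag_mx (\row_i expR (t * d 0 i)).
Proof.
apply/matrixP => i j; rewrite !mxE.
have -> : (fun N => wcoef (diag_mx d) Bs N 0 i j) = fun N => (i == j)%:R * d 0 i ^+ N.
  apply/funext => N; rewrite wcoef0r.
  have -> : diag_mx d ^+ N = diag_mx (\row_i (d 0 i ^+ N)).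
    elim: N => [|N IH]; first by apply/matrixP => a b; rewrite !mxE expr0.
    rewrite exprS IH -[LHS]/(diag_mx d *m _); apply/matrixP => a b; rewrite mul_diag_mx !mxE.
    by rewrite mulrnAr -exprS.
  by rewrite !mxE mulr_natl.
have gb : geometric_bound `|d 0 i| (fun N => d 0 i ^+ N).
  by exists 1 => N; rewrite mul1r normrX.
by rewrite (egf_scale _ _ (normr_ge0 _) gb) egf_exp mulr_natl.
Qed.

(** * Time-ordered products as sums over labels *)

Lemma dec_times_lt {R : realType} (K : finType) (t : R) (l : seq (K * R)) :
  dec_times t l -> all (fun x => x.2 < t) l.
Proof.
elim: l t => [|x l IH] t //= /and3P[_ xt /IH hl]; rewrite xt /=.
by apply: sub_all hl => y /= /lt_trans; apply.
Qed.

(** * The last bridge endpoint below a given time *)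

Section LastEndpoint.
Context {R : realType} {d l : nat} (beta : R) (s : seq (edge d l * bool * R)).
Hypothesis gs : good_times beta s.
Implicit Types (p q : ep s) (i : 'I_(size s)) (t : R) (y : site d l).

Lemma ep_time_inj p q : ep_time p = ep_time q -> p.1 = q.1.
Proof.
case/andP: gs => us _; rewrite /ep_time /br => e; apply: val_inj.
have x0 : edge d l * bool * R by exact: (tnth (in_tuple s) p.1).
move: e; rewrite !(tnth_nth x0) /= => e; apply/eqP.
rewrite -(nth_uniq 0 _ _ us) ?size_map// !(nth_map x0)//; exact/eqP.
Qed.

Lemma ep_time_bounds p : 0 < ep_time p < beta.
Proof. by case/andP: gs => _ /allP; apply; exact: mem_tnth. Qed.

Lemma edge_neq (e : edge d l) : (val e).1 != (val e).2.
Proof.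
case: e => [[x y] /= /andP[/eqP e _]]; apply: contra_eq_neq e => /= ->.
by rewrite /l1dist big1// => i _; rewrite subnn.
Qed.

Lemma ep_site_neg i b : ep_site (i, ~~ b) != ep_site (i, b).
Proof. by rewrite /ep_site; case: b => /=; [|rewrite eq_sym]; exact: edge_neq. Qed.

Lemma ep_inj p q : ep_site p = ep_site q -> ep_time p = ep_time q -> p = q.
Proof.
case: p q => [i b] [j c] e /ep_time_inj /= eij; rewrite -{}eij in e *.
have [->//|bc] := eqVneq b c; have := ep_site_neg i c.
have -> : ~~ c = b by case: (b) (c) bc => -[].
by rewrite e eqxx.
Qed.

(** The lower end of the vertical piece just below (y, t); [None] means that this piece reaches down
    to time 0. *)
Definition lastb t y : option (ep s) :=
  [pick q : ep s | [&& ep_site q == y, ep_time q < t &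
    [forall q' : ep s, (ep_site q' == y) && (ep_time q' < t) ==> (ep_time q' <= ep_time q)]]].

Variant lastb_spec t y : option (ep s) -> Type :=
| LastbSome q of ep_site q = y & ep_time q < t &
    (forall q', ep_site q' = y -> ep_time q' < t -> ep_time q' <= ep_time q) :
    lastb_spec t y (Some q)
| LastbNone of (forall q', ep_site q' = y -> t <= ep_time q') : lastb_spec t y None.

Lemma lastbP t y : lastb_spec t y (lastb t y).
Proof.
rewrite /lastb; case: pickP => [q /and3P[/eqP qy qt /forallP hq]|none].
  constructor=> // q' /eqP q'y q't; have := hq q'; rewrite q'y q't; exact.
constructor=> q' /eqP q'y; rewrite leNgt; apply/negP => q't.
pose P q := (ep_site q == y) && (ep_time q < t).
have Pq' : P q' by rewrite /P q'y.
have [q /andP[qy qt] qmax] := Order.TotalTheory.arg_maxP (@ep_time _ _ _ s) Pq'.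
have := none q; rewrite qy qt /=; move/negbT/forallPn => [q''].
by rewrite negb_imply => /andP[Pq'']; have /= -> := qmax _ Pq''.
Qed.

Lemma lastb_Some t y q : ep_site q = y -> ep_time q < t ->
  (forall q', ep_site q' = y -> ep_time q' < t -> ep_time q' <= ep_time q) ->
  lastb t y = Some q.
Proof.
move=> qy qt hq; case: lastbP => [q1 q1y q1t h1|/(_ _ qy)]; last by rewrite leNgt qt.
congr Some; apply: ep_inj; first by rewrite qy.
by apply/eqP; rewrite eq_le hq// h1.
Qed.

Lemma lastb_None t y : (forall q, ep_site q = y -> t <= ep_time q) -> lastb t y = None.
Proof. by move=> hn; case: lastbP => // q /hn; rewrite leNgt => /negP. Qed.

Section Step.
Variables (t : R) (i : 'I_(size s)).
Hypothesis it : ep_time (i, true) < t.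
Hypothesis imax : forall q, ep_time q < t -> ep_time q <= ep_time (i, true).

Lemma lastb_step_in b : lastb t (ep_site (i, b)) = Some (i, b).
Proof. by apply: lastb_Some => // q' _ /imax. Qed.

Lemma lastb_step_out y : (forall b, y != ep_site (i, b)) ->
  lastb t y = lastb (ep_time (i, true)) y.
Proof.
move=> yi.
have hlt q : ep_site q = y -> ep_time q < t -> ep_time q < ep_time (i, true).
  move=> qy /imax; rewrite le_eqVlt => /orP[/eqP /ep_time_inj /= qi|//].
  by have := yi q.2; rewrite -qy {1}[q]surjective_pairing qi eqxx.
have hgt q : ep_time q < ep_time (i, true) -> ep_time q < t by move/lt_trans; apply.
case: (lastbP t y) => [q qy qt hq|hn].
  by symmetry; apply: lastb_Some => // [|q' q'y /hgt]; [exact: hlt|exact: hq].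
symmetry; apply: lastb_None => q /hn; exact/le_trans/ltW.
Qed.

End Step.

(** The default 0 is the start of a piece that has no endpoint below it. *)
Definition tbelow t y : R := if lastb t y is Some q then ep_time q else 0.

End LastEndpoint.

(** * Matrix elements of ordered products as label sums *)

Section Transfer.
Context {R : realType} {d l nS : nat} (beta : R) (h : site d l -> R)
  (s : seq (edge d l * bool * R)) (w : edge d l * bool -> R).
Hypothesis gs : good_times beta s.
Notation conf := (conf d l nS).
Notation N := #|{: conf}|.
Implicit Types (a sg r : conf) (chi : {ffun hp s -> 'I_nS.+1}) (i : 'I_(size s)) (t : R).

Definition ent (M : 'M[R]_N) sg a : R := M (enum_rank sg) (enum_rank a).

Lemma ent_opmx f sg a : ent (opmx f) sg a = f sg a.
Proof. by rewrite /ent mxE !enum_rankK. Qed.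

Lemma ent_mul (M M' : 'M[R]_N) sg a : ent (M *m M') sg a = \sum_r ent M sg r * ent M' r a.
Proof.
rewrite /ent mxE (reindex (@enum_rank {: conf}))//.
by exists enum_val => x _; [exact: enum_rankK|exact: enum_valK].
Qed.

Lemma trace_ent (M : 'M[R]_N) : \tr M = \sum_a ent M a a.
Proof.
rewrite /mxtrace (reindex (@enum_rank {: conf}))//.
by exists enum_val => x _; [exact: enum_rankK|exact: enum_valK].
Qed.

Definition energy a : R := \sum_y h y * spin (a y).

(** The subtracted number of edges gathers the [-1] of every edge term of the Hamiltonian. *)
Definition fieldmx : 'M[R]_N :=
  diag_mx (\row_i (energy (enum_val i) - #|{: edge d l}|%:R)).

Definition bridgemx (eb : edge d l * bool) : 'M[R]_N :=
  if eb.2 then Tmx nS (val eb.1).1 (val eb.1).2 else Qmx nS (val eb.1).1 (val eb.1).2.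

Lemma ent_dyson0 Bs t sg a : ent (dyson fieldmx Bs 0 t) sg a =
  (sg == a)%:R * expR (t * (energy sg - #|{: edge d l}|%:R)).
Proof.
rewrite /ent dyson0_diag !mxE enum_rankK (can_eq enum_rankK).
by case: eqP; rewrite ?mul1r ?mul0r.
Qed.

Definition compat i chi := [forall b, forall c, chi (M2 ((i, b), c)) == chi ((i, b), c)].

(* The configuration just before time [t], when the one at time 0 is [a]. *)
Definition cf t a chi : conf :=
  [ffun y => if lastb s t y is Some q then chi (q, true) else a y].

Definition slice_weight t a chi : R :=
  \prod_y expR (h y * spin (cf t a chi y) * (t - tbelow s t y)).

(** A bridge is charged with its compatibility condition and, at both endpoints, with the continuity
    and field weight of the vertical piece that ends there from below. *)
Definition bridge_weight a chi i : R :=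
  (compat i chi)%:R *
  \prod_b ((chi ((i, b), false) == cf (ep_time (i, b)) a chi (ep_site (i, b)))%:R *
     expR (h (ep_site (i, b)) * spin (chi ((i, b), false)) *
       (ep_time (i, b) - tbelow s (ep_time (i, b)) (ep_site (i, b))))).

(** Labels of bridges outside [L] are pinned to a default, so that each history is counted once. *)
Definition supported (L : seq 'I_(size s)) chi :=
  [forall g, (g.1.1 \notin L) ==> (chi g == ord0)].

Lemma ent_bridgemx i sg r (chi : {ffun hp s -> 'I_nS.+1}) :
  (forall b, chi ((i, b), true) = sg (ep_site (i, b))) ->
  (forall b, chi ((i, b), false) = r (ep_site (i, b))) ->
  ent (bridgemx (br i).1) sg r =
  ((sg == [ffun y => if [exists b, y == ep_site (i, b)] then sg y else r y]) && compat i chi)%:R.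
Proof.
move=> ct cb; rewrite /bridgemx; set x := (val (br i).1.1).1; set y := (val (br i).1.1).2.
have xy : x != y by exact: edge_neq.
have sf : ep_site (i, false) = x by [].
have st : ep_site (i, true) = y by [].
have ex z : [exists b, z == ep_site (i, b)] = (z == x) || (z == y).
  apply/existsP/orP => [[[]]|[]]; rewrite ?sf ?st; first by right.
  - by left.
  - by exists false.
  - by exists true.
have offE (r1 : conf) : (sg == [ffun z => if [exists b, z == ep_site (i, b)] then sg z else r1 z]) =
    [forall z, ((z != x) && (z != y)) ==> (sg z == r1 z)].
  apply/eqP/forallP => [-> z|hz].
    by apply/implyP => /andP[zx zy]; rewrite ffunE ex (negbTE zx) (negbTE zy).
  apply/ffunP => z; rewrite ffunE ex; have := hz z; rewrite -negb_or.
  by case: orP => //= _ /eqP.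
have compE : compat i chi = if (br i).1.2 then (sg x == r y) && (sg y == r x)
     else (sg x == sg y) && (r x == r y).
  have m2 b c : M2 ((i, b), c) = if (br i).1.2 then ((i, ~~ b), ~~ c) else ((i, ~~ b), c).
    by rewrite /M2 /ep_cross /=; case: ifP.
  apply/forallP/idP => [hc|].
    have h1 := forallP (hc false) true; have h2 := forallP (hc true) true.
    have h3 := forallP (hc false) false; move: h1 h2 h3; rewrite !m2.
    case: ifP => _ /=; rewrite !ct !cb sf st.
      by move=> /eqP-> /eqP-> _; rewrite !eqxx.
    by move=> /eqP-> _ /eqP->; rewrite !eqxx.
  by move=> hc b; apply/forallP => c; rewrite m2; move: hc; case: ifP => _;
     case: b; case: c => /=; rewrite !(ct, cb) sf st => /andP[/eqP e1 /eqP e2]; rewrite ?e1 ?e2 ?eqxx.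
rewrite offE compE; case: ((br i).1.2); rewrite ent_opmx; congr (nat_of_bool _)%:R.
  apply/eqP/andP => [->|[/forallP hz /andP[/eqP e1 /eqP e2]]].
    split; last by rewrite !ffunE eqxx [y == x]eq_sym (negbTE xy) !eqxx.
    by apply/forallP => z; apply/implyP => /andP[zx zy]; rewrite ffunE (negbTE zx) (negbTE zy).
  apply/ffunP => z; rewrite ffunE; case: eqVneq => [->//|zx]; case: eqVneq => [->//|zy].
  by have := hz z; rewrite zx zy => /eqP.
by rewrite andbA andbC.
Qed.

Lemma eq_cf t a (chi chi' : {ffun hp s -> 'I_nS.+1}) :
  (forall q, ep_time q < t -> chi (q, true) = chi' (q, true)) -> cf t a chi = cf t a chi'.
Proof.
move=> e; apply/ffunP => y; rewrite !ffunE.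
by case: lastbP => // q _ qt _; exact: e.
Qed.

Lemma eq_bridge_weight a (chi chi' : {ffun hp s -> 'I_nS.+1}) i :
  (forall q c, ep_time q <= ep_time (i, true) -> chi (q, c) = chi' (q, c)) ->
  bridge_weight a chi i = bridge_weight a chi' i.
Proof.
move=> e; rewrite /bridge_weight; congr (_ * _).
  congr (nat_of_bool _)%:R; apply: eq_forallb => b; apply: eq_forallb => c.
  have e2 (c' b' : bool) : chi ((i, b'), c') = chi' ((i, b'), c') by apply: e.
  by rewrite /M2 /=; case: ifP; rewrite !e2.
apply: eq_bigr => b _; have -> : chi ((i, b), false) = chi' ((i, b), false) by apply: e.
by rewrite (@eq_cf _ a chi chi')// => q /ltW; exact: e.
Qed.

Lemma prod_bridge_sites i (F : site d l -> R) :
  \prod_b F (ep_site (i, b)) = \prod_y (if [exists b, y == ep_site (i, b)] then F y else 1).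
Proof.
rewrite -big_mkcond (bigD1 (ep_site (i, true))) /=; last by apply/existsP; exists true.
rewrite (big_pred1 (ep_site (i, false))) ?big_bool// => y /=.
apply/andP/eqP => [[/existsP[[] /eqP->]]|->]; rewrite ?eqxx//.
by rewrite (ep_site_neg i true); split => //; apply/existsP; exists false.
Qed.

(** Induction from the latest bridge downwards. The configuration above that bridge fixes its upper
    labels and the one below fixes its lower labels, so summing over the intermediate configuration
    amounts to summing over labels. *)
Lemma transfer (L : seq 'I_(size s)) t sg a : dec_times t [seq br i | i <- L] ->
  (forall i, (i \in L) = (ep_time (i, true) < t)) ->
  ent (wprod fieldmx w bridgemx [seq br i | i <- L] 0 t) sg a =
  expR (- t * #|{: edge d l}|%:R) * \sum_(chi | supported L chi)
    (sg == cf t a chi)%:R * slice_weight t a chi * \prod_(i <- L) bridge_weight a chi i.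
Proof.
elim: L t sg => [|i L IH] t sg /=.
  move=> _ hL; have nl y : lastb s t y = None.
    apply: lastb_None => // q _; rewrite leNgt.
    by have := hL q.1; rewrite in_nil => /esym/negbT.
  rewrite ent_dyson0 (big_pred1 [ffun=> ord0]) => [|chi]; last first.
    apply/forallP/eqP => [hc|-> g]; last by rewrite ffunE eqxx implybT.
    by apply/ffunP => g; rewrite ffunE; exact/eqP/(hc g).
  have -> : cf t a [ffun=> ord0] = a by apply/ffunP => y; rewrite ffunE nl.
  rewrite big_nil mulr1 mulrCA; case: eqP => [->|]; last by rewrite !mul0r.
  rewrite !mul1r mulrBr expRD mulNr mulrC; congr (_ * _).
  rewrite /slice_weight -expR_sum mulr_sumr; congr expR; apply: eq_bigr => y _.
  by rewrite ffunE nl /tbelow nl subr0 mulrC.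
rewrite [br i]surjective_pairing => /and3P[/= ti0 tit dL] hL.
pose tau : R := ep_time (i, true).
have Llt j : j \in L -> ep_time (j, true) < tau.
  by move=> jL; have := allP (dec_times_lt dL) (br j); apply; exact: map_f.
have iL : i \notin L by apply/negP => /Llt; rewrite ltxx.
have hL' j : (j \in L) = (ep_time (j, true) < tau).
  apply/idP/idP => [/Llt//|jt]; have := hL j; rewrite inE (lt_trans jt tit).
  by case/orP => // /eqP ji; move: jt; rewrite ji ltxx.
have imax (q : ep s) : ep_time q < t -> ep_time q <= tau.
  move=> qt; have := hL q.1; rewrite inE [RHS]qt => /orP[/eqP qi|/Llt /ltW//].
  by rewrite /tau /ep_time qi.
have cft chi : cf t a chi =
    [ffun y => if [exists b, y == ep_site (i, b)]
               then (if y == ep_site (i, true) then chi ((i, true), true) else chi ((i, false), true))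
               else cf tau a chi y].
  apply/ffunP => y; rewrite [LHS]ffunE [RHS]ffunE; case: existsP => [[b /eqP->]|nex].
    rewrite (lastb_step_in gs)//; case: b => /=; first by rewrite eqxx.
    by rewrite (negbTE (ep_site_neg i true)).
  rewrite ffunE (lastb_step_out gs tit imax)// => b; apply/negP => e; apply: nex.
  by exists b.
have dec0 r : ent (dyson fieldmx (\sum_b w b *: bridgemx b) 0 (t - tau) *m bridgemx (br i).1) sg r =
    expR ((t - tau) * (energy sg - #|{: edge d l}|%:R)) * ent (bridgemx (br i).1) sg r.
  rewrite ent_mul; move: (\sum_b w b *: bridgemx b) => Bs.
  rewrite (bigD1 sg)//= big1; last first.
    by move=> r' /negbTE rs; rewrite ent_dyson0 eq_sym rs !mul0r.
  by rewrite ent_dyson0 eqxx mul1r addr0.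
rewrite big_ord1 ent_mul.
transitivity (\sum_(chi | supported L chi) \sum_r
    expR ((t - tau) * (energy sg - #|{: edge d l}|%:R)) * ent (bridgemx (br i).1) sg r *
    (expR (- tau * #|{: edge d l}|%:R) * ((r == cf tau a chi)%:R * slice_weight tau a chi *
       \prod_(j <- L) bridge_weight a chi j))).
  rewrite [RHS]exchange_big /=; apply: eq_bigr => r _.
  by rewrite (dec0 r) (IH tau r dL hL') !mulr_sumr.
(* Labels violating [Q] contribute zero: the upper condition comes from the final configuration, the
   lower one from [bridge_weight]. *)
pose Q chi := [forall b, (chi ((i, b), true) == sg (ep_site (i, b))) &&
   (chi ((i, b), false) == cf tau a chi (ep_site (i, b)))].
have -> : \sum_(chi | supported (i :: L) chi) (sg == cf t a chi)%:R * slice_weight t a chi *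
     \prod_(j <- i :: L) bridge_weight a chi j =
   \sum_(chi | supported (i :: L) chi && Q chi) (sg == cf t a chi)%:R * slice_weight t a chi *
     \prod_(j <- i :: L) bridge_weight a chi j.
  rewrite big_mkcondr /=; apply: eq_bigr => chi _.
  case: ifP => // /negbT /forallPn[b]; rewrite negb_and.
  have [->|_] := eqVneq sg (cf t a chi); last by rewrite !mul0r.
  rewrite ffunE (lastb_step_in gs)// eqxx /= => nb.
  rewrite big_cons {1}/bridge_weight (bigD1 b)//= (negbTE nb) !mul0r mulr0 mul0r mulr0.
  by [].
(* Labels on the earlier bridges extend in one way to bridge [i]; [restr] resets the new ones to the
   default demanded by [supported]. *)
pose ext chi : {ffun hp s -> 'I_nS.+1} := [ffun g => if g.1.1 == i then
   (if g.2 then sg (ep_site g.1) else cf tau a chi (ep_site g.1)) else chi g].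
pose restr chi : {ffun hp s -> 'I_nS.+1} := [ffun g => if g.1.1 == i then ord0 else chi g].
have ltni (q : ep s) : ep_time q < tau -> (q.1 == i) = false.
  by move=> qt; apply/negP => /eqP qi; move: qt; rewrite /tau -qi ltxx.
have cfe chi : cf tau a (ext chi) = cf tau a chi.
  by apply: eq_cf => q qt; rewrite ffunE /= ltni.
have cfr chi : cf tau a (restr chi) = cf tau a chi.
  by apply: eq_cf => q qt; rewrite ffunE /= ltni.
rewrite mulr_sumr [RHS](reindex_onto ext restr) /=; last first.
  move=> chi /andP[_ /forallP hQ]; apply/ffunP => -[[j b] c]; rewrite [LHS]ffunE /= cfr [restr chi _]ffunE /=.
  by case: eqP => // ->; have /andP[/eqP e1 /eqP e2] := hQ b; case: c.
apply: eq_big => [chi|chi sc].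
  apply/forallP/andP => [hc|[/andP[/forallP h1 _] /eqP h2] g]; last first.
    apply/implyP => gL; have := congr1 (fun f : {ffun hp s -> 'I_nS.+1} => f g) h2.
    rewrite !ffunE; case: eqP => [_ <-//|/eqP gi _]; have := h1 g.
    by rewrite inE negb_or gi gL /= ffunE (negbTE gi).
  split; first (apply/andP; split).
  - apply/forallP => g; apply/implyP; rewrite inE negb_or => /andP[gi gL].
    by have := hc g; rewrite gL ffunE (negbTE gi).
  - by apply/forallP => b; rewrite cfe !ffunE /= eqxx !eqxx.
  - apply/eqP/ffunP => g; rewrite !ffunE; case: eqP => // gi.
    by have := hc g; rewrite gi iL /= => /eqP.
rewrite big_cons.
have -> : \prod_(j <- L) bridge_weight a (ext chi) j = \prod_(j <- L) bridge_weight a chi j.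
  apply: eq_big_seq => j /Llt jt; apply: eq_bridge_weight => q c qj.
  by rewrite ffunE /= ltni// (le_lt_trans qj).
set r := cf tau a chi; set P := \prod_(j <- L) _.
pose c' : conf := [ffun y => if [exists b, y == ep_site (i, b)] then sg y else r y].
have cfc : cf t a (ext chi) = c'.
  rewrite cft cfe; apply/ffunP => y; rewrite [LHS]ffunE [RHS]ffunE; case: existsP => // -[b /eqP->].
  by rewrite !ffunE /= eqxx; case: b; rewrite ?eqxx// (negbTE (ep_site_neg i true)).
rewrite (bigD1 r)//= big1 ?addr0; last first.
  by move=> r' /negbTE r'r; rewrite -/r r'r !(mul0r, mulr0).
rewrite -/r eqxx mul1r.
rewrite (@ent_bridgemx i sg r (ext chi)); last 2 first.
- by move=> b; rewrite ffunE /= eqxx.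
- by move=> b; rewrite ffunE /= eqxx.
rewrite -/c' cfc; have [sc'|_] := eqVneq sg c'; last by rewrite !(mul0r, mulr0).
(* At the two sites of [i] the field weight below [tau] is charged to the bridge and a new piece
   starts at [tau]; at all other sites the current piece just grows by t - tau. *)
have key : slice_weight t a (ext chi) * \prod_b
      (((ext chi) (i, b, false) == cf (ep_time (i, b)) a (ext chi) (ep_site (i, b)))%:R *
       expR (h (ep_site (i, b)) * spin ((ext chi) (i, b, false)) *
         (ep_time (i, b) - tbelow s (ep_time (i, b)) (ep_site (i, b))))) =
   expR ((t - tau) * energy sg) * slice_weight tau a chi.
  rewrite [X in _ * X](eq_bigr (fun b => expR (h (ep_site (i, b)) * spin (r (ep_site (i, b))) *
         (tau - tbelow s tau (ep_site (i, b)))))); last first.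
    by move=> b _; rewrite -[ep_time (i, b)]/tau cfe ffunE /= eqxx eqxx mul1r.
  rewrite (prod_bridge_sites i (fun y => expR (h y * spin (r y) * (tau - tbelow s tau y)))).
  rewrite /slice_weight /energy mulr_sumr expR_sum -!big_split /=; apply: eq_bigr => y _.
  rewrite cfc -/c' -sc'; case: existsP => [[b /eqP->]|nex].
    rewrite {1}/tbelow (lastb_step_in gs)// -[ep_time (i, b)]/tau; congr (_ * _).
    by congr expR; rewrite mulrC.
  have yi b : y != ep_site (i, b) by apply/negP => e; apply: nex; exists b.
  rewrite {1}/tbelow (lastb_step_out gs tit imax)// mulr1 -expRD; congr expR.
  have -> : r y = sg y.
    by rewrite sc' [RHS]ffunE; case: ifP => // /existsP /nex.
  rewrite -/tau -/(tbelow s tau y).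
  by move: (tbelow s tau y) (h y) (spin (sg y)) (tau) => b1 h1 s1 t1; ring.
rewrite mulrBr expRD !mulNr.
have -> : expR (- (t * #|{: edge d l}|%:R)) =
   expR (- ((t - tau) * #|{: edge d l}|%:R)) * expR (- (tau * #|{: edge d l}|%:R)) :> R.
  by rewrite -expRD -opprD -mulrDl subrK.
move: key; rewrite /= mul1r /bridge_weight.
set x1 := slice_weight t _ _; set x2 := \prod_b _; set x3 := expR _; set x4 := slice_weight _ _ _.
set x5 := expR _; set x6 := expR _; set x7 := (compat _ _)%:R => key.
clearbody x1 x2 x3 x4 x5 x6 x7 P.
have -> : x1 * (x7 * x2 * P) = x7 * P * (x1 * x2) by ring.
rewrite key; ring.
Qed.

End Transfer.

(** * Vertical segments *)

Section CyclicOrder.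
Context {R : realType} {d l : nat} (beta : R) (h : site d l -> R)
  (s : seq (edge d l * bool * R)).
Hypothesis gs : good_times beta s.
Implicit Types (p q : ep s) (y : site d l).
Notation next := (@Defs.next R d l beta s).
Notation prev := (@Defs.prev R d l beta s).
Notation gap := (@Defs.gap R d l beta s).

Lemma nextP p : ep_site (next p) = ep_site p /\
  (forall q, ep_site q = ep_site p -> gap p (next p) <= gap p q).
Proof.
rewrite /Defs.next; case: Order.TotalTheory.arg_minP => // q /eqP qp hq.
by split => // q' /eqP; exact: hq.
Qed.

Lemma prevP p : ep_site (prev p) = ep_site p /\
  (forall q, ep_site q = ep_site p -> gap (prev p) p <= gap q p).
Proof.
rewrite /Defs.prev; case: Order.TotalTheory.arg_minP => // q /eqP qp hq.
by split => // q' /eqP; exact: hq.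
Qed.

Lemma prev_unique p q : ep_site q = ep_site p ->
  (forall q', ep_site q' = ep_site p -> gap q p <= gap q' p) -> prev p = q.
Proof.
move=> qp hq; have [pp hp] := prevP p; apply: (ep_inj gs); first by rewrite pp.
have := hq _ pp; have := hp _ qp.
have := ep_time_bounds gs p; have := ep_time_bounds gs q; have := ep_time_bounds gs (prev p).
rewrite /Defs.gap; move: (prev p) => p' /andP[? ?] /andP[? ?] /andP[? ?].
by case: ltP => ?; case: ltP => ? ? ?; lra.
Qed.

Lemma prev_lastb_Some p q : lastb s (ep_time p) (ep_site p) = Some q -> prev p = q.
Proof.
case: lastbP => // q1 q1p q1t hq1 [<-]; apply: prev_unique => // q' q'p.
have := ep_time_bounds gs p; have := ep_time_bounds gs q1; have := ep_time_bounds gs q'.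
move=> /andP[? ?] /andP[? ?] /andP[? ?]; have := hq1 _ q'p.
rewrite /Defs.gap q1t; case: ltP => [? /(_ isT)|? _]; lra.
Qed.

Lemma lastb_beta p q : lastb s beta (ep_site p) = Some q ->
  ep_site q = ep_site p /\ (forall q', ep_site q' = ep_site p -> ep_time q' <= ep_time q).
Proof.
case: lastbP => // q1 q1p _ hq1 [<-]; split => // q' q'p; apply: hq1 => //.
by case/andP: (ep_time_bounds gs q').
Qed.

Lemma prev_lastb_None p q : lastb s (ep_time p) (ep_site p) = None ->
  lastb s beta (ep_site p) = Some q -> prev p = q.
Proof.
case: lastbP => // hn _ /lastb_beta[qp hq]; apply: prev_unique => // q' q'p.
rewrite /Defs.gap !ltNge !hn//=; have := hq _ q'p; lra.
Qed.

Lemma lastb_beta_Some p : exists q, lastb s beta (ep_site p) = Some q.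
Proof.
case: lastbP => [q ? ? ?|/(_ p erefl)]; first by exists q.
by rewrite leNgt; case/andP: (ep_time_bounds gs p) => _ ->.
Qed.

(** An endpoint with a smaller gap to [next p] than [p] has would lie strictly inside the segment
    starting at [p], against the minimality of [next p]. *)
Lemma nextK : cancel next prev.
Proof.
move=> p; have [np hn] := nextP p; apply: prev_unique => // p'; rewrite np => p'p.
have := hn _ p'p; move: (next p) => q.
have := ep_time_bounds gs p; have := ep_time_bounds gs q; have := ep_time_bounds gs p'.
move=> /andP[? ?] /andP[? ?] /andP[? ?]; rewrite /Defs.gap.
by case: ltP => ?; case: ltP => ?; case: ltP => ? ?; lra.
Qed.

Lemma prevK : cancel prev next.
Proof. exact: canF_sym nextK. Qed.

Lemma next_site p : ep_site (next p) = ep_site p. Proof. by case: (nextP p). Qed.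
Lemma prev_site p : ep_site (prev p) = ep_site p. Proof. by case: (prevP p). Qed.

(** Segments through time 0 start at a [top_ep] and end at a [low_ep]. *)
Definition top_ep p := lastb s beta (ep_site p) == Some p.
Definition low_ep p := lastb s (ep_time p) (ep_site p) == None.

Lemma low_prev_top p : low_ep p = top_ep (prev p).
Proof.
have [q hq] := lastb_beta_Some p; rewrite /top_ep prev_site hq /low_ep.
case e : (lastb s (ep_time p) (ep_site p)) => [q'|]; last first.
  by rewrite (prev_lastb_None e hq) eqxx.
rewrite (prev_lastb_Some e); symmetry; apply/negP => /eqP[eq].
move: e; case: lastbP => // q1 _ q1t _ [e1]; have [_ /(_ p erefl)] := lastb_beta hq.
by rewrite eq -e1 leNgt q1t.
Qed.

Lemma low_next_top p : low_ep (next p) = top_ep p.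
Proof. by rewrite low_prev_top nextK. Qed.

(* The segment through time 0 at a site is the only one shared by two half-points: its part
   before time [beta] is charged to its lower end and its part after time 0 to its upper end;
   every other segment is charged to its upper end. *)
Definition hw (g : hp s) : R :=
  if g.2 then (if top_ep g.1 then h (ep_site g.1) * (beta - ep_time g.1) else 0)
  else h (ep_site g.1) * (ep_time g.1 - tbelow s (ep_time g.1) (ep_site g.1)).

Lemma hw_segment p : hw (p, true) + hw (next p, false) = segw beta h p.
Proof.
rewrite /hw /segw /= next_site; have := low_next_top p; rewrite /low_ep next_site /tbelow.
have := ep_time_bounds gs p; have := ep_time_bounds gs (next p).
move=> /andP[? ?] /andP[? ?].
case: ifP => [tp /eqP->|ntp].
  have [_ /(_ (next p) (next_site p))] := lastb_beta (eqP tp).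
  by rewrite /Defs.gap leNgt => /negbTE->; ring.
case e : (lastb s (ep_time (next p)) (ep_site p)) => [q|//] _.
rewrite -next_site in e; have := prev_lastb_Some e; rewrite nextK => pq.
move: e; case: lastbP => // q1 _ q1t _ [e1]; rewrite -e1 in pq.
have tp : ep_time p = ep_time q1 by rewrite pq.
by rewrite -e1 /Defs.gap tp q1t; ring.
Qed.

Lemma seg0E y : seg0 s y = lastb s beta y.
Proof.
rewrite /seg0 /lastb; apply: eq_pick => p /=.
have tb q : ep_time q < beta by case/andP: (ep_time_bounds gs q).
rewrite tb /=; congr (_ && _); apply: eq_forallb => q; by rewrite tb andbT.
Qed.

Lemma empty_lastb t y : empty_site s y -> lastb s t y = None.
Proof. by move=> /forallP ey; apply: lastb_None => // q qy; have := ey q; rewrite qy eqxx. Qed.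

Lemma nonempty_lastb y : ~~ empty_site s y -> exists q, lastb s beta y = Some q.
Proof. by move=> /forallPn[q]; rewrite negbK => /eqP<-; exact: lastb_beta_Some. Qed.

End CyclicOrder.

Lemma perm_eq_mapP (T1 T2 : eqType) (f : T1 -> T2) e (m : seq T2) :
  perm_eq m (map f e) -> exists2 e', perm_eq e' e & m = map f e'.
Proof.
elim: m e => [|x m IH] e pe.
  by exists [::] => //; move: (perm_size pe); rewrite size_map; case: e {pe}.
have : x \in map f e by rewrite -(perm_mem pe) mem_head.
case/mapP => y ye xy; have per := perm_to_rem ye.
have := perm_trans pe (perm_map f per); rewrite /= -xy perm_cons => /IH[e' pe' ->].
exists (y :: e'); last by rewrite xy.
by rewrite perm_sym (perm_trans per)// perm_cons perm_sym.
Qed.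

Lemma prodr_bool (R : comPzRingType) (I : finType) (P : pred I) :
  \prod_i (P i)%:R = [forall i, P i]%:R :> R.
Proof.
case: (boolP [forall i, P i]) => [/forallP hP|/forallPn[i /negbTE ni]].
  by rewrite big1// => i _; rewrite hP.
by rewrite (bigD1 i)//= ni mul0r.
Qed.

(** * Factorization of the trace over sites *)

Section SiteFactorization.
Context {R : realType} {d l nS : nat} (beta : R) (h : site d l -> R)
  (s : seq (edge d l * bool * R)) (w : edge d l * bool -> R).
Hypothesis gs : good_times beta s.
Notation conf := (conf d l nS).
Notation N := #|{: conf}|.
Variables (X : site d l -> 'I_nS.+1 -> 'I_nS.+1 -> R) (Xm : 'M[R]_N).
Hypothesis XmE : forall a sg : conf, ent Xm a sg = \prod_y X y (a y) (sg y).
Implicit Types (chi : {ffun hp s -> 'I_nS.+1}) (k : 'I_nS.+1) (y : site d l).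

Lemma trace_transfer :
  \tr (Xm *m wprod (fieldmx h) w (@bridgemx _ _ _ nS) (sort_times [::] s) 0 beta) =
  expR (- beta * #|{: edge d l}|%:R) * \sum_(chi : {ffun hp s -> 'I_nS.+1}) \sum_(a : conf)
    (\prod_y X y (a y) (cf beta a chi y)) * slice_weight h beta a chi *
    \prod_i bridge_weight h a chi i.
Proof.
have pe : perm_eq (sort_times [::] s) [seq br i | i <- enum 'I_(size s)].
  by rewrite map_tnth_enum (perm_trans (perm_sort_times s [::]))// cats0.
have [L pL eL] := perm_eq_mapP pe.
have dL : dec_times beta [seq br i | i <- L].
  by rewrite -eL; apply: sort_times_dec => //; rewrite cats0.
have hL i : (i \in L) = (ep_time (i, true) < beta).
  by rewrite (perm_mem pL) mem_enum; case/andP: (ep_time_bounds gs (i, true)) => _ ->.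
rewrite eL trace_ent.
under eq_bigr => a _ do rewrite ent_mul.
under eq_bigr => a _ do under eq_bigr => sg _ do rewrite (transfer h w gs sg a dL hL) XmE.
rewrite [in RHS]exchange_big /= mulr_sumr; apply: eq_bigr => a _.
transitivity (expR (- beta * #|{: edge d l}|%:R) *
  \sum_(sg : conf) \sum_(chi | supported L chi) \prod_y X y (a y) (sg y) * ((sg == cf beta a chi)%:R
    * slice_weight h beta a chi * \prod_(i <- L) bridge_weight h a chi i)).
  rewrite mulr_sumr; apply: eq_bigr => sg _; rewrite mulrCA; congr (_ * _).
  by rewrite mulr_sumr.
congr (_ * _); rewrite exchange_big /=; apply: eq_big => [chi|chi _].
  apply/forallP => g; rewrite hL; case/andP: (ep_time_bounds gs (g.1.1, true)) => _ ->.
  by [].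
rewrite (bigD1 (cf beta a chi))//= [X in _ + X]big1; last first.
  by move=> sg /negbTE->; rewrite !mul0r mulr0.
rewrite addr0 eqxx mul1r !mulrA; congr (_ * _).
by rewrite (perm_big _ pL) big_enum.
Qed.

Definition label t y chi k := if lastb s t y is Some q then chi (q, true) else k.

Definition site_factor y chi k : R :=
  X y k (label beta y chi k) *
  expR (h y * spin (label beta y chi k) * (beta - tbelow s beta y)) *
  \prod_(p : ep s | ep_site p == y)
    ((chi (p, false) == label (ep_time p) y chi k)%:R *
     expR (h y * spin (chi (p, false)) * (ep_time p - tbelow s (ep_time p) y))).

(** Once the labels are fixed, every factor attached to site [y] sees the boundary configuration
    only through [a y], and compatibility does not see it at all; the sum over [a] then distributes
    over sites. *)
Lemma sum_site_factor chi :
  \sum_(a : conf) (\prod_y X y (a y) (cf beta a chi y)) * slice_weight h beta a chi *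
    \prod_i bridge_weight h a chi i =
  (\prod_i (compat i chi)%:R) * \prod_y \sum_k site_factor y chi k.
Proof.
rewrite bigA_distr_bigA /= mulr_sumr; apply: eq_bigr => a _.
rewrite /site_factor /slice_weight /bridge_weight !big_split /= mulrCA; congr (_ * _).
congr (_ * _ * _); [by apply: eq_bigr => y _; rewrite ffunE|by apply: eq_bigr => y _; rewrite ffunE|].
pose F (p : ep s) := (chi (p, false) == cf (ep_time p) a chi (ep_site p))%:R *
  expR (h (ep_site p) * spin (chi (p, false)) *
    (ep_time p - tbelow s (ep_time p) (ep_site p))).
transitivity (\prod_(p : ep s) F p).
  transitivity (\prod_i \prod_b F (i, b)); first by [].
  by rewrite pair_bigA; apply: eq_bigr => -[].
rewrite (partition_big (fun p : ep s => ep_site p) xpredT) //=.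
apply: eq_bigr => y _; apply: eq_bigr => p /eqP siy.
by rewrite /F ffunE siy.
Qed.

(** The segment through time 0 is exempt, since its condition depends on the observable and sits in
    [observable_factor]. *)
Definition vertical_ok chi (p : ep s) :=
  low_ep p || (chi (p, false) == chi (Defs.prev beta p, true)).

(** [X] compares the label just after time 0, held by the half-point below the lowest endpoint, with
    the one just before [beta], above the highest endpoint. Sites without bridges are summed
    separately, hence the value 1. *)
Definition observable_factor y chi : R :=
  if lastb s beta y is Some q then X y (chi (Defs.next beta q, false)) (chi (q, true)) else 1.

Lemma sum_site_factor_empty y chi : empty_site s y ->
  \sum_k site_factor y chi k = \sum_k X y k k * expR (spin k * (h y * beta)).
Proof.
move=> ey; apply: eq_bigr => k _; rewrite /site_factor /label /tbelow !(empty_lastb _ ey)//.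
rewrite big_pred0 ?mulr1 => [|p]; last by have /negbTE := forallP ey p.
by congr (_ * expR _); ring.
Qed.

Lemma sum_site_factor_nonempty y chi : ~~ empty_site s y ->
  \sum_k site_factor y chi k = observable_factor y chi *
    \prod_(p : ep s | ep_site p == y) ((vertical_ok chi p)%:R *
      (expR (spin (chi (p, true)) * hw beta h (p, true)) *
       expR (spin (chi (p, false)) * hw beta h (p, false)))).
Proof.
move=> /(nonempty_lastb gs)[q0 hq0].
have q0y : ep_site q0 = y by move: hq0; case: lastbP => // q ? _ _ [<-].
have tq0 : top_ep beta q0 by rewrite /top_ep q0y hq0.
pose p1 := Defs.next beta q0.
have p1y : ep_site p1 = y by rewrite next_site.
have lp1 : lastb s (ep_time p1) y = None.
  by have := low_next_top gs q0; rewrite tq0 /low_ep -/p1 p1y => /eqP.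
have low1 p : ep_site p = y -> lastb s (ep_time p) y = None -> p = p1.
  move=> py lp; rewrite /p1 -(prevK gs p); congr (Defs.next beta _).
  by apply: (prev_lastb_None gs); rewrite py.
(* Continuity below the lowest endpoint [p1] forces the boundary value, so the sum over [k] has a
   single term. *)
rewrite (bigD1 (chi (p1, false)))//= [X in _ + X]big1 ?addr0; last first.
  move=> k nk; rewrite /site_factor (bigD1 p1) ?p1y//= /label lp1 eq_sym (negbTE nk).
  by rewrite !mul0r mulr0.
rewrite /site_factor /observable_factor /label hq0 -/p1 /tbelow hq0 -!mulrA; congr (_ * _).
rewrite [RHS](eq_bigr (fun p : ep s => expR (spin (chi (p, true)) * hw beta h (p, true)) *
   ((vertical_ok chi p)%:R * expR (spin (chi (p, false)) * hw beta h (p, false))))); last first.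
  by move=> p _; rewrite mulrCA.
rewrite [RHS]big_split /=; congr (_ * _).
  rewrite (bigD1 q0) ?q0y//= [X in _ = _ * X]big1 ?mulr1; last first.
    move=> p /andP[/eqP py pq]; rewrite /hw /= ifF ?mulr0 ?expR0// /top_ep py hq0; apply/negP => /eqP[e].
    by rewrite e eqxx in pq.
  by rewrite /hw /= tq0 q0y; congr expR; ring.
apply: eq_bigr => p /eqP py; congr (_ * _); last first.
  by rewrite /hw /= py /tbelow; congr expR; ring.
rewrite /vertical_ok /low_ep py.
case e : (lastb s (ep_time p) y) => [q|]; last by rewrite (low1 p py e) !eqxx.
by rewrite (prev_lastb_Some gs (q := q)) ?py.
Qed.

Definition bridge_ok chi := [forall i, compat i chi].

Lemma trace_label_sum :
  \tr (Xm *m wprod (fieldmx h) w (@bridgemx _ _ _ nS) (sort_times [::] s) 0 beta) =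
  expR (- beta * #|{: edge d l}|%:R) *
  (\prod_(y | empty_site s y) \sum_k X y k k * expR (spin k * (h y * beta))) *
  \sum_(chi | bridge_ok chi && [forall p, vertical_ok chi p])
    (\prod_y observable_factor y chi) * \prod_g expR (spin (chi g) * hw beta h g).
Proof.
rewrite trace_transfer -mulrA; congr (_ * _); rewrite mulr_sumr [RHS]big_mkcond.
apply: eq_bigr => chi _; rewrite sum_site_factor (bigID (empty_site s)) /=.
rewrite (eq_bigr _ (fun y => sum_site_factor_empty (y := y) chi)).
rewrite [X in _ * (_ * X) = _](eq_bigr _ (fun y => sum_site_factor_nonempty (y := y) chi)).
rewrite big_split /=.
have -> : \prod_(y | ~~ empty_site s y) observable_factor y chi = \prod_y observable_factor y chi.
  rewrite big_mkcond; apply: eq_bigr => y _; case: ifP => // /negbFE ey.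
  by rewrite /observable_factor empty_lastb.
have -> : \prod_(y | ~~ empty_site s y) \prod_(p : ep s | ep_site p == y) ((vertical_ok chi p)%:R *
      (expR (spin (chi (p, true)) * hw beta h (p, true)) *
       expR (spin (chi (p, false)) * hw beta h (p, false)))) =
   [forall p, vertical_ok chi p]%:R * \prod_g expR (spin (chi g) * hw beta h g).
  transitivity (\prod_(p : ep s) ((vertical_ok chi p)%:R *
      (expR (spin (chi (p, true)) * hw beta h (p, true)) *
       expR (spin (chi (p, false)) * hw beta h (p, false))))).
    rewrite [RHS](partition_big (fun p : ep s => ep_site p) (fun y => ~~ empty_site s y)) //=.
    by move=> p _; apply/forallPn; exists p; rewrite negbK.
  rewrite big_split /= prodr_bool; congr (_ * _).
  transitivity (\prod_(p : ep s) \prod_b expR (spin (chi (p, b)) * hw beta h (p, b))).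
    by apply: eq_bigr => p _; rewrite big_bool.
  by rewrite pair_bigA; apply: eq_bigr => -[].
rewrite prodr_bool -/(bridge_ok chi); case: (bridge_ok chi) => /=; last by rewrite mul0r.
by case: [forall p, _] => /=; rewrite ?mul0r ?mulr0 ?mul1r.
Qed.

End SiteFactorization.

(** * Sums over labels constant on blocks *)

Section BlockSums.
Context {R : comPzRingType} (V I : finType) (k0 : I).
Implicit Types (P : {set {set V}}) (F : V -> I -> R) (chi : {ffun V -> I}).

Definition const_on P chi :=
  [forall B in P, forall v in B, forall v' in B, chi v == chi v'].

Lemma const_onP P chi :
  reflect (forall B v v', B \in P -> v \in B -> v' \in B -> chi v = chi v') (const_on P chi).
Proof.
apply: (iffP forall_inP) => [hc B v v' BP vB v'B|hc B BP].
  by have /forall_inP/(_ v vB)/forall_inP/(_ v' v'B)/eqP := hc B BP.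
by apply/forall_inP => v vB; apply/forall_inP => v' v'B; apply/eqP; exact: (hc B).
Qed.

Lemma sum_const_blocks P F : finset.partition P [set: V] ->
  \sum_(chi | const_on P chi) \prod_v F v (chi v) =
  \prod_(B in P) \sum_k \prod_(v in B) F v k.
Proof.
move=> /and3P[/eqP cP tP P0]; rewrite (big_distr_big k0) /=.
have pbP v : finset.pblock P v \in P by apply: pblock_mem; rewrite cP inE.
have vpb v : v \in finset.pblock P v by rewrite mem_pblock cP inE.
pose ext (f : {ffun {set V} -> I}) : {ffun V -> I} := [ffun v => f (finset.pblock P v)].
(* Outside [P] the value must be the default [k0] of the distributivity formula, or the
   correspondence would not be one to one. *)
pose restr (chi : {ffun V -> I}) : {ffun {set V} -> I} :=
  [ffun B : {set V} => if B \in P then (if [pick v in B] is Some v then chi v else k0) else k0].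
rewrite (reindex_onto ext restr) /=; last first.
  move=> chi /const_onP hc; apply/ffunP => v; rewrite !ffunE pbP.
  case: pickP => [v' v'B|/(_ v)]; last by rewrite vpb.
  exact: (hc _ _ _ (pbP v)).
apply: eq_big => [f|f _].
  have -> : const_on P (ext f).
    apply/const_onP => B v v' BP vB v'B; rewrite !ffunE.
    by rewrite (def_pblock tP BP vB) (def_pblock tP BP v'B).
  apply/eqP/pfamilyP => [<-|[/fintype.subsetP fs _]].
    split => //; apply/fintype.subsetP => B; rewrite !inE ffunE; case: ifP => //.
    by rewrite eqxx.
  apply/ffunP => B; rewrite !ffunE; case: ifP => [BP|/negbT BP]; last first.
    by apply/esym/eqP; apply/negPn/negP => /fs; rewrite (negbTE BP).
  case: pickP => [v vB|B0]; first by rewrite ffunE (def_pblock tP BP vB).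
  case/negP: P0; suff -> : finset.set0 = B by [].
  by apply/setP => v; rewrite inE; apply/esym; exact: B0.
rewrite [RHS](eq_bigr (fun B : {set V} => \prod_(v in B) F v (f (finset.pblock P v)))); last first.
  by move=> B BP; apply: eq_bigr => v vB; rewrite (def_pblock tP BP vB).
rewrite -(finset.big_trivIset _ tP) /= cP; apply: eq_big => [v|v _]; first by rewrite inE.
by rewrite ffunE.
Qed.

(** The coupling [Y] prevents factorization. Fixing the labels at [a] and [a'] by indicators
    attached to these two points restores a product over points, to which [sum_const_blocks]
    applies. *)
Lemma sum_const_blocks2 P F (Y : I -> I -> R) (A A' : {set V}) a a' :
  finset.partition P [set: V] -> A \in P -> A' \in P -> A != A' -> a \in A -> a' \in A' ->
  \sum_(chi | const_on P chi) Y (chi a) (chi a') * \prod_v F v (chi v) =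
  (\sum_k \sum_k' Y k k' * ((\prod_(v in A) F v k) * \prod_(v in A') F v k')) *
  \prod_(B in P | (B != A) && (B != A')) \sum_k \prod_(v in B) F v k.
Proof.
move=> pP AP A'P AA' aA a'A'; have /and3P[_ tP _] := pP.
pose F' k k' v c := F v c * ((if v == a then (c == k)%:R else 1) *
   (if v == a' then (c == k')%:R else 1)).
have prod1 (Q : pred V) (b : V) (G : V -> R) :
   \prod_(v | Q v) (if v == b then G v else 1) = if Q b then G b else 1.
  case: ifP => Qb; last first.
    by rewrite big1// => v Qv; case: eqP => // vb; rewrite vb Qb in Qv.
  rewrite (bigD1 b)//= eqxx big1 ?mulr1// => v /andP[_ /negbTE->//].
transitivity (\sum_k \sum_k' Y k k' * \sum_(chi | const_on P chi) \prod_v F' k k' v (chi v)).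
  under [RHS]eq_bigr => k _ do under eq_bigr => k' _ do rewrite mulr_sumr.
  under [RHS]eq_bigr => k _ do rewrite exchange_big /=.
  rewrite [RHS]exchange_big /=; apply: eq_bigr => chi _.
  rewrite (bigD1 (chi a))//= (bigD1 (chi a'))//=.
  have e k k' : \prod_v F' k k' v (chi v) =
      (\prod_v F v (chi v)) * ((chi a == k)%:R * (chi a' == k')%:R).
    by rewrite /F' !big_split /= (prod1 xpredT a (fun v => (chi v == k)%:R))
      (prod1 xpredT a' (fun v => (chi v == k')%:R)).
  rewrite e !eqxx !mulr1 [X in _ + X + _]big1 ?addr0; last first.
    by move=> k' nk; rewrite e [chi a' == k']eq_sym (negbTE nk) !mulr0.
  rewrite [X in _ = _ + X]big1 ?addr0// => k nk; rewrite big1// => k' _.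
  by rewrite e [chi a == k]eq_sym (negbTE nk) !(mul0r, mulr0).
rewrite mulr_suml; apply: eq_bigr => k _; rewrite mulr_suml; apply: eq_bigr => k' _.
rewrite -mulrA; congr (_ * _); rewrite (sum_const_blocks _ pP).
have A'c : (A' \in P) && (A' != A) by rewrite A'P eq_sym.
rewrite (bigD1 A AP) /= [X in _ * X = _](bigD1 A' A'c) /=.
have eF (B : {set V}) c : \prod_(v in B) F' k k' v c = (\prod_(v in B) F v c) *
   ((if a \in B then (c == k)%:R else 1) * (if a' \in B then (c == k')%:R else 1)).
  by rewrite /F' !big_split /= (prod1 (mem B) a (fun=> (c == k)%:R))
      (prod1 (mem B) a' (fun=> (c == k')%:R)).
have nB B v (B' : {set V}) : B \in P -> B' \in P -> v \in B' -> B != B' -> (v \in B) = false.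
  move=> BP B'P vB' BB'; apply/negP => vB; case/eqP: BB'.
  by rewrite -(def_pblock tP BP vB) -(def_pblock tP B'P vB').
rewrite mulrA; congr (_ * _ * _).
- rewrite (bigD1 k)//= eF aA (nB A a' A')// eqxx !mulr1 [X in _ + X]big1 ?addr0// => c nc.
  by rewrite eF aA (negbTE nc) !(mul0r, mulr0).
- rewrite (bigD1 k')//= eF a'A' (nB A' a A) 1?eq_sym// eqxx !mulr1 [X in _ + X]big1 ?addr0// => c nc.
  by rewrite eF a'A' (negbTE nc) !(mul0r, mulr0).
apply: eq_big => [B|B]; first by rewrite andbA.
case/andP => /andP[BP BA] BA'; apply: eq_bigr => c _.
by rewrite eF (nB B a A)// (nB B a' A')// !mulr1.
Qed.

End BlockSums.

(** * Loops generated by two involutions *)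

Section DihedralOrbits.
Context (V : finType) (m1 m2 : V -> V).
Hypotheses (m1K : involutive m1) (m2K : involutive m2).
Hypotheses (m1_fix : forall v, m1 v != v) (m2_fix : forall v, m2 v != v).
Implicit Types (v g : V).

Definition zigzag v := m2 (m1 v).
Notation f := zigzag.
Definition zrel : rel V := fun g g' => [|| g' == m1 g, g' == m2 g, g == m1 g' | g == m2 g'].

Lemma zrelE g g' : zrel g g' = (g' == m1 g) || (g' == m2 g).
Proof.
have e m : involutive m -> (g == m g') = (g' == m g).
  by move=> mK; apply/eqP/eqP => ->; rewrite mK.
by rewrite /zrel !e//; case: (_ == m1 g); case: (_ == m2 g).
Qed.

Lemma zrel_sym : symmetric zrel.
Proof. by move=> g g'; rewrite /zrel orbA orbC -!orbA. Qed.

Lemma zconnect_sym : connect_sym zrel.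
Proof. exact: sym_connect_sym zrel_sym. Qed.

Definition orbits : {set {set V}} := [set [set g' | connect zrel g g'] | g : V].

Lemma orbits_partition : finset.partition orbits [set: V].
Proof.
have -> : orbits = equivalence_partition (connect zrel) [set: V].
  rewrite /orbits /equivalence_partition; apply/setP => C; apply/imsetP/imsetP.
    by move=> [g _ ->]; exists g => //; apply/setP => g'; rewrite !inE.
  by move=> [g _ ->]; exists g => //; apply/setP => g'; rewrite !inE.
apply/equivalence_partitionP => x y z _ _ _; split; first exact: connect0.
by move=> xy; exact: (same_connect zconnect_sym).
Qed.

Lemma orbit_mem1 C v : C \in orbits -> (m1 v \in C) = (v \in C).
Proof.
case/imsetP => g _ ->; rewrite !inE; apply: (same_connect_r zconnect_sym).
by apply: connect1; rewrite zrelE m1K eqxx.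
Qed.

Lemma connect_invariant (T : eqType) (chi : V -> T) g g' :
  (forall v, connect zrel g v -> chi (m1 v) = chi v) ->
  (forall v, connect zrel g v -> chi (m2 v) = chi v) ->
  connect zrel g g' -> chi g' = chi g.
Proof.
move=> h1 h2 /connectP[p pp ->]; elim/last_ind: p pp => [|p x IH] //.
rewrite rcons_path last_rcons => /andP[pp]; rewrite zrelE.
have cl : connect zrel g (last g p) by apply/connectP; exists p.
by case/orP => /eqP->; rewrite ?h1 ?h2// IH.
Qed.

Lemma const_orbits (T : finType) (chi : {ffun V -> T}) : const_on orbits chi <->
  (forall v, chi (m2 v) = chi v) /\ (forall v, chi (m1 v) = chi v).
Proof.
split=> [/const_onP hc|[h2 h1]].
  have same v v' : connect zrel v v' -> chi v' = chi v.
    move=> cvv'; apply: (hc [set u | connect zrel v u]); first exact: imset_f.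
      by rewrite inE.
    by rewrite inE connect0.
  by split=> v; apply/same/connect1; rewrite zrelE eqxx ?orbT.
apply/const_onP => B v v' /imsetP[g _ ->]; rewrite !inE => cv cv'.
by rewrite (connect_invariant _ _ cv) ?(connect_invariant _ _ cv').
Qed.

Lemma zigzag_inj : injective f.
Proof. by move=> v v' e; apply: (can_inj m1K); apply: (can_inj m2K). Qed.

(** The dihedral relation: [m1] conjugates the walk to its inverse. *)
Lemma m1_zigzag j v : iter j f (m1 (iter j f v)) = m1 v.
Proof.
elim: j v => [|j IH] v //=; rewrite -iterS iterSr -[in RHS](IH v); congr (iter j f _).
by rewrite /zigzag m1K m2K.
Qed.

(* The two involutions have no fixed point, so a loop cannot close up with reversed orientation. *)
Lemma zigzag_m1_neq j v : iter j f v != m1 v.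
Proof.
apply/eqP => e; have := odd_double_half j; set i := j./2.
case: (odd j) => /= ej.
  have := m1_fix (iter i f v); have := m2_fix (m1 (iter i f v)).
  have : iter i f (f (iter i f v)) = iter i f (m1 (iter i f v)).
    by rewrite m1_zigzag -e -iterS -iterD -ej -addnn addnC addSn.
  have inji : injective (iter i f) by elim: (i) => //= ? IHi ? ? /zigzag_inj/IHi.
  by move/inji; rewrite /zigzag => ->; rewrite eqxx.
have := m1_fix (iter i f v).
have inji : injective (iter i f) by elim: (i) => //= ? IHi ? ? /zigzag_inj/IHi.
have : iter i f (iter i f v) = iter i f (m1 (iter i f v)).
  by rewrite m1_zigzag -e -iterD addnn -ej.
by move/inji => <-; rewrite eqxx.
Qed.

Lemma zigzag_neq_m1 i j v : iter i f v != m1 (iter j f v).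
Proof.
have [ij|/ltnW ji] := leqP j i.
  by rewrite -(subnK ij) iterD zigzag_m1_neq.
rewrite -(inj_eq (can_inj m1K)) m1K eq_sym -(subnK ji) iterD.
exact: zigzag_m1_neq.
Qed.

Section Cut.
Variables (g0 gx : V).
Hypothesis gx_g0 : gx != g0.
Hypothesis gx_m1 : gx != m1 g0.

Let r := order f g0.
Definition on_gx v := (v == gx) || (v == m1 gx).
Definition on_cut v := [|| v == g0, v == m1 g0 | on_gx v].

Lemma on_gx_m1 v : on_gx (m1 v) = on_gx v.
Proof. by rewrite /on_gx (inj_eq (can_inj m1K)) orbC -{2}[gx]m1K (inj_eq (can_inj m1K)) ?m1K. Qed.

Lemma on_cut_m1 v : on_cut (m1 v) = on_cut v.
Proof.
rewrite /on_cut on_gx_m1 (inj_eq (can_inj m1K)) -{1}[g0]m1K (inj_eq (can_inj m1K)).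
by rewrite orbCA.
Qed.

Lemma zigzag_order : iter r f g0 = g0.
Proof. exact: (iter_order zigzag_inj). Qed.

Lemma order_gt0_zigzag : (0 < r)%N. Proof. exact: order_gt0. Qed.

Lemma zigzag_iter_inj i j : (i < r)%N -> (j < r)%N -> iter i f g0 = iter j f g0 -> i = j.
Proof.
move=> ir jr e; have := orbit_uniq f g0.
rewrite /orbit => /(nth_uniq g0) H; apply/eqP.
by rewrite -(H i j) ?size_traject// !nth_traject// e.
Qed.

Lemma connect_zigzag v : connect zrel g0 v ->
  exists2 j, (j < r)%N & (v = iter j f g0) \/ (v = m1 (iter j f g0)).
Proof.
move=> /connectP[p pp ->]; elim/last_ind: p pp => [|p x IH] pp.
  by exists 0%N; [exact: order_gt0_zigzag|left].
move: pp; rewrite rcons_path last_rcons => /andP[/IH{IH}[j jr hj]]; rewrite zrelE.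
case/orP => /eqP->.
  by exists j => //; case: hj => ->; [right|left; rewrite m1K].
case: hj => ->; last first.
  have [jr'|jr'] := ltnP j.+1 r; first by exists j.+1 => //; left.
  exists 0%N; [exact: order_gt0_zigzag|left].
  have -> : iter 0 f g0 = iter r f g0 by rewrite zigzag_order.
  by have -> : r = j.+1 by apply/eqP; rewrite eqn_leq jr'.
case: j jr => [|j] jr; last first.
  by exists j; [exact: ltnW|right; rewrite /= /zigzag m2K].
exists r.-1; first by rewrite ltn_predL order_gt0_zigzag.
right; rewrite /= -[X in m2 X]zigzag_order -(prednK order_gt0_zigzag) /= /zigzag m2K.
by [].
Qed.

Lemma iter_connect j : connect zrel g0 (iter j f g0).
Proof.
elim: j => [|j IH]; first exact: connect0.
apply: (connect_trans IH); apply: (@connect_trans _ _ (m1 (iter j f g0))).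
  by apply: connect1; rewrite zrelE eqxx.
by apply: connect1; rewrite zrelE eqxx orbT.
Qed.

Definition cut_invariant (T : eqType) (chi : V -> T) :=
  (forall v, chi (m2 v) = chi v) /\ (forall v, ~~ on_cut v -> chi (m1 v) = chi v).

(** A loop cut only once stays connected: the walk from [m1 g0] returns to [g0] the other way round
    without meeting another cut. *)
Lemma cut_not_connected (T : eqType) (chi : V -> T) :
  ~~ connect zrel g0 gx -> cut_invariant chi -> chi (m1 g0) = chi g0.
Proof.
move=> ncx [h2 h1].
have nx j : ~~ on_gx (iter j f g0).
  apply/negP => /orP[] /eqP e; case/negP: ncx; first by rewrite -e iter_connect.
  apply: (connect_trans (iter_connect j)); rewrite e; apply: connect1.
  by rewrite zrelE m1K eqxx.
suff H j : (j < r)%N -> chi (iter j.+1 f g0) = chi (m1 g0).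
  have := H r.-1; rewrite (prednK order_gt0_zigzag) zigzag_order => -> //.
elim: j => [|j IH] jr; first by rewrite /= /zigzag h2.
rewrite [iter j.+2 f g0]/= {1}/zigzag h2 h1 ?IH 1?ltnW//.
rewrite -[f _]/(iter j.+1 f g0) /on_cut 2!negb_or nx andbT; apply/andP; split; last exact: zigzag_m1_neq.
apply/eqP => e; have := @zigzag_iter_inj j.+1 0 jr order_gt0_zigzag e; by [].
Qed.

Section Connected.
Variable K : nat.
Hypothesis Kgx : on_gx (iter K.+1 f g0).
Hypothesis Kmin : forall j, (j < K)%N -> ~~ on_gx (iter j.+1 f g0).
Let j0 := K.+1.

(* A union of [m2]-pairs, listed along the walk from [m1 g0] to the other cut. *)
Definition cut_arc : {set V} :=
  [set v | [exists j : 'I_j0, (v == m1 (iter j f g0)) || (v == iter j.+1 f g0)]].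

Lemma arcP v : reflect (exists2 j, (j < j0)%N & v = m1 (iter j f g0) \/ v = iter j.+1 f g0)
  (v \in cut_arc).
Proof.
rewrite inE; apply: (iffP existsP) => [[j /orP[]/eqP->]|[j jj [->|->]]].
- by exists (j : nat) => //; left.
- by exists (j : nat) => //; right.
- by exists (Ordinal jj); rewrite eqxx.
- by exists (Ordinal jj); rewrite eqxx orbT.
Qed.

(** The walk has period [r], so a first visit to the cut at [gx] after a full turn could be moved to
    an earlier step; a visit exactly at the return would put both cuts on the same segment. *)
Lemma K_lt_order : (K.+1 < r)%N.
Proof.
rewrite ltnNge; apply/negP => rK.
have rx : ~~ on_gx (iter r f g0).
  by rewrite zigzag_order /on_gx negb_or eq_sym gx_g0 /= -(inj_eq (can_inj m1K)) m1K eq_sym gx_m1.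
have [e|ne] := eqVneq r K.+1; first by rewrite e Kgx in rx.
have rK' : (r < K.+1)%N by rewrite ltn_neqAle ne.
have kr : (K.+1 - r <= K)%N by rewrite leq_subLR addnC -addn1 leq_add2l order_gt0_zigzag.
have : on_gx (iter (K.+1 - r) f g0) by rewrite -{1}zigzag_order -iterD subnK// Kgx.
have : (0 < K.+1 - r)%N by rewrite subn_gt0.
case e : (K.+1 - r)%N => [|k] // _; apply/negP/Kmin.
by rewrite -ltnS -e ltnS.
Qed.

Lemma noncut_iter j : (0 < j)%N -> (j < r)%N -> j != K.+1 -> ~~ on_cut (iter j f g0).
Proof.
move=> j0' jr jK; rewrite /on_cut !negb_or zigzag_m1_neq /=; apply/andP; split.
  apply/eqP => e; have := @zigzag_iter_inj j 0 jr order_gt0_zigzag e => j0e.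
  by rewrite j0e in j0'.
apply/andP; split; apply/negP => /eqP e; case/orP: Kgx => /eqP ex.
- by case/eqP: jK; apply: zigzag_iter_inj => //; [exact: K_lt_order|rewrite e ex].
- by have := zigzag_neq_m1 K.+1 j g0; rewrite e ex eqxx.
- by have := zigzag_neq_m1 j K.+1 g0; rewrite e ex eqxx.
- by case/eqP: jK; apply: zigzag_iter_inj => //; [exact: K_lt_order|rewrite e ex].
Qed.

Lemma arc_m2 v : (m2 v \in cut_arc) = (v \in cut_arc).
Proof.
have H u : u \in cut_arc -> m2 u \in cut_arc.
  case/arcP => j jj [->|->]; apply/arcP; exists j => //; first by right.
  by left; rewrite /= /zigzag m2K.
by apply/idP/idP => /H //; rewrite m2K.
Qed.

Lemma arc_m1 v : ~~ on_cut v -> (m1 v \in cut_arc) = (v \in cut_arc).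
Proof.
have H u : ~~ on_cut u -> u \in cut_arc -> m1 u \in cut_arc.
  move=> nu /arcP[j jj hu]; apply/arcP; case: hu => e.
    case: j e jj => [|j] e jj; last by exists j; [exact: ltnW|right; rewrite e m1K].
    by move: nu; rewrite e /on_cut eqxx orbT.
  exists j.+1; last by left; rewrite e.
  rewrite /j0 !ltnS; rewrite /j0 ltnS in jj; rewrite ltn_neqAle jj andbT.
  by apply: contraNneq nu => jK; rewrite e jK /on_cut Kgx !orbT.
move=> nv; apply/idP/idP => [|/H]; last exact.
by move/H; rewrite on_cut_m1 m1K; exact.
Qed.

Lemma arc_sub : cut_arc \subset [set v | connect zrel g0 v].
Proof.
apply/fintype.subsetP => v /arcP[j _ [->|->]]; rewrite inE; last exact: iter_connect.
apply: (connect_trans (iter_connect j)); apply: connect1.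
by rewrite zrelE eqxx.
Qed.

Lemma g0_notin_arc : g0 \notin cut_arc.
Proof.
apply/arcP => -[j jj [e|e]]; first by have := zigzag_neq_m1 0 j g0; rewrite -e eqxx.
have := @zigzag_iter_inj 0 j.+1 order_gt0_zigzag _ e; rewrite (leq_ltn_trans jj K_lt_order).
by move/(_ isT).
Qed.

Lemma m1g0_in_arc : m1 g0 \in cut_arc.
Proof. by apply/arcP; exists 0%N => //; left. Qed.

Lemma end_in_arc : iter K.+1 f g0 \in cut_arc.
Proof. by apply/arcP; exists K => //; right. Qed.

Lemma m1end_notin_arc : m1 (iter K.+1 f g0) \notin cut_arc.
Proof.
apply/arcP => -[j jj [/(can_inj m1K) e|e]]; last first.
  by have := zigzag_neq_m1 j.+1 K.+1 g0; rewrite -e eqxx.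
have := @zigzag_iter_inj _ j K_lt_order (ltn_trans jj K_lt_order) e.
by move=> jK; rewrite -jK ltnn in jj.
Qed.

Lemma arc_const (T : eqType) (chi : V -> T) v :
  cut_invariant chi -> v \in cut_arc -> chi v = chi (m1 g0).
Proof.
move=> [h2 h1] /arcP[j jj hv].
have H i : (i < j0)%N -> chi (m1 (iter i f g0)) = chi (m1 g0).
  elim: i => [|i IH] ii //; rewrite h1; last first.
    by apply: noncut_iter; rewrite ?(ltn_trans ii K_lt_order)//; apply: contraTneq ii => ->; rewrite ltnn.
  by rewrite /= {1}/zigzag h2 IH// ltnW.
by case: hv => ->; rewrite ?H//= {1}/zigzag h2 H.
Qed.

(** The complementary arc is followed backwards from the return to [g0] at step [r], hence an
    induction on r - i. *)
Lemma coarc_const (T : eqType) (chi : V -> T) v :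
  cut_invariant chi -> connect zrel g0 v -> v \notin cut_arc -> chi v = chi g0.
Proof.
move=> [h2 h1] /connect_zigzag[j jr hv] nv.
have H i : (i <= r)%N -> (K.+1 < i)%N -> chi (iter i f g0) = chi g0.
  move=> ir; rewrite -(subKn ir); move: (r - i)%N (leq_subr i r) => m {i ir}.
  elim: m => [|m IH] mr Km; first by rewrite subn0 zigzag_order.
  have sr : (r - m.+1 < r)%N by rewrite ltn_subrL order_gt0_zigzag.
  rewrite -h1; last first.
    by apply: noncut_iter => //; [exact: leq_ltn_trans Km|rewrite gtn_eqF].
  rewrite -h2 -[m2 _]/(iter (r - m.+1).+1 f g0) -subSn// subSS IH 1?ltnW//.
  by lia.
have [jK|Kj] := leqP j K.
  case: hv => e; last by case/arcP: nv; exists j => //; left.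
  case: j jr jK e => [|j] jr jK e; first by rewrite e.
  by case/arcP: nv; exists j; [exact: ltnW|right].
have [ej|nj] := eqVneq j K.+1; last first.
  have Hj : chi (iter j f g0) = chi g0 by apply: H; [exact: ltnW|rewrite ltn_neqAle eq_sym nj].
  by case: hv => ->//; rewrite h1// noncut_iter// (leq_ltn_trans _ Kj).
case: hv => e; first by case/negP: nv; rewrite e ej end_in_arc.
rewrite e -h2 -[m2 _]/(iter j.+1 f g0); by apply: H => //; rewrite ej.
Qed.

Let C0 : {set V} := [set v | connect zrel g0 v].

Definition cut_orbits : {set {set V}} := cut_arc |: ((C0 :\: cut_arc) |: (orbits :\ C0)).

Lemma C0_orbit : C0 \in orbits. Proof. exact: imset_f. Qed.

Lemma cut_orbits_partition : finset.partition cut_orbits [set: V].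
Proof.
have pD := partitionD1 orbits_partition C0_orbit.
have n1 : C0 :\: cut_arc != finset.set0.
  by apply/set0Pn; exists g0; rewrite finset.in_setD g0_notin_arc inE connect0.
have sub : cut_arc \subset C0 := arc_sub.
have d1 : [disjoint C0 :\: cut_arc & [set: V] :\: C0].
  rewrite -finset.setI_eq0; apply/eqP/setP => v.
  rewrite finset.in_setI !finset.in_setD finset.in_set0 finset.in_setT.
  by case: (v \in C0); rewrite ?andbF.
have p1 := partitionU1 pD n1 d1.
have n2 : cut_arc != finset.set0 by apply/set0Pn; exists (m1 g0); exact: m1g0_in_arc.
have d2 : [disjoint cut_arc & (C0 :\: cut_arc) :|: ([set: V] :\: C0)].
  rewrite -finset.setI_eq0; apply/eqP/setP => v.
  rewrite finset.in_setI finset.in_setU !finset.in_setD finset.in_set0 finset.in_setT.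
  have := fintype.subsetP sub v.
  by case: (v \in cut_arc) => //= /(_ isT) ->.
have := partitionU1 p1 n2 d2; congr (finset.partition _ _).
apply/setP => v; rewrite !finset.in_setU !finset.in_setD finset.in_setT.
by case: (v \in cut_arc) => //=; case: (v \in C0).
Qed.

(** All cut points lie in [C0], which falls apart into the two arcs; every other orbit keeps both
    involutions intact and remains a block. *)
Lemma const_cut_orbits (T : finType) (chi : {ffun V -> T}) :
  const_on cut_orbits chi <-> cut_invariant chi.
Proof.
split=> [/const_onP hc|ci]; last first.
  apply/const_onP => B v v'; rewrite !finset.in_setU1 finset.in_setD1.
  case/or3P => [/eqP->|/eqP->|/andP[BC0 Borb]].
  - by move=> va v'a; rewrite !(arc_const ci).
  - rewrite !finset.in_setD => /andP[va cv] /andP[v'a cv'].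
    by rewrite inE in cv; rewrite inE in cv'; rewrite !(coarc_const ci).
  - case: ci => h2 h1; move: (Borb); case/imsetP => g _ eB vB v'B.
    have nc u : connect zrel g u -> ~~ on_cut u.
      move=> gu; apply: contra BC0 => cu; apply/eqP.
      have uC0 : u \in C0.
        rewrite inE; case/or3P: cu => [/eqP->|/eqP->|ux]; first exact: connect0.
          by apply: connect1; rewrite zrelE eqxx.
        have cx : connect zrel g0 (iter K.+1 f g0) by exact: iter_connect.
        have c1 v1 : connect zrel v1 (m1 v1) by apply: connect1; rewrite zrelE eqxx.
        have c2 v1 : connect zrel (m1 v1) v1 by rewrite zconnect_sym.
        case/orP: Kgx => /eqP ex; rewrite ex in cx; case/orP: ux => /eqP-> //.
          exact: connect_trans cx (c1 _).
        exact: connect_trans cx (c2 _).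
      have /and3P[_ tP _] := orbits_partition.
      have uB : u \in B by rewrite eB inE.
      by rewrite -(def_pblock tP Borb uB) -(def_pblock tP C0_orbit uC0).
    move: vB v'B; rewrite eB !inE => cv cv'.
    have inv u : connect zrel g u -> chi u = chi g.
      by apply: connect_invariant => u' cu'; [exact: h1 (nc _ cu')|exact: h2].
    by rewrite (inv _ cv) (inv _ cv').
have same v v' : (v \in cut_arc) = (v' \in cut_arc) -> connect zrel v v' -> chi v' = chi v.
  move=> eA cvv'; have [va|nva] := boolP (v \in cut_arc).
    by apply: (hc cut_arc); rewrite -?eA// finset.in_setU1 eqxx.
  have [vC|vC] := boolP (v \in C0).
    apply: (hc (C0 :\: cut_arc)); first by rewrite !finset.in_setU1 eqxx orbT.
      rewrite finset.in_setD -eA nva /= inE; rewrite inE in vC; exact: connect_trans cvv'.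
    by rewrite finset.in_setD nva.
  pose B : {set V} := [set u | connect zrel v u].
  apply: (hc B); last 2 first.
  - by rewrite inE.
  - by rewrite inE connect0.
  rewrite !finset.in_setU1 finset.in_setD1; apply/orP; right; apply/orP; right.
  rewrite imset_f ?inE// andbT; apply: contra vC => /eqP<-.
  by rewrite inE connect0.
split=> v => [|nv]; apply: same; rewrite ?arc_m2 ?arc_m1//; apply: connect1;
  by rewrite zrelE eqxx ?orbT.
Qed.

Lemma sum_arc (W : nmodType) (F : V -> W) :
  \sum_(v in cut_arc) F v = \sum_(j < j0) (F (m1 (iter j f g0)) + F (iter j.+1 f g0)).
Proof.
have jr (j : 'I_j0) : (j < r)%N by apply: ltn_trans K_lt_order; exact: ltn_ord.
have jr1 (j : 'I_j0) : (j.+1 < r)%N by apply: leq_ltn_trans K_lt_order; exact: ltn_ord.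
have i1 : injective (fun j : 'I_j0 => m1 (iter j f g0)).
  by move=> i j /(can_inj m1K) /(zigzag_iter_inj (jr i) (jr j)) /val_inj.
have i2 : injective (fun j : 'I_j0 => iter j.+1 f g0).
  by move=> i j /(zigzag_iter_inj (jr1 i) (jr1 j)) [] /val_inj.
pose A1 := [set m1 (iter j f g0) | j : 'I_j0]; pose A2 := [set iter j.+1 f g0 | j : 'I_j0].
have eA : cut_arc = A1 :|: A2.
  apply/setP => v; rewrite finset.in_setU; apply/arcP/orP => [[j jj [->|->]]|[/imsetP[j _ ->]|/imsetP[j _ ->]]].
  - by left; apply/imsetP; exists (Ordinal jj).
  - by right; apply/imsetP; exists (Ordinal jj).
  - by exists (j : nat) => //; left.
  - by exists (j : nat) => //; right.
have dA : [disjoint A1 & A2].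
  rewrite -finset.setI_eq0; apply/eqP/setP => v; rewrite finset.in_setI finset.in_set0.
  apply/negP => /andP[/imsetP[i _ ->] /imsetP[j _] e].
  by have := zigzag_neq_m1 j.+1 i g0; rewrite e eqxx.
rewrite (eq_bigl (mem [predU A1 & A2])) => [|v]; last by rewrite eA finset.in_setU inE.
rewrite bigU//= !big_imset /=; last 2 first.
- by move=> ? ? _ _; exact: i2.
- by move=> ? ? _ _; exact: i1.
by rewrite big_split.
Qed.

End Connected.
End Cut.
End DihedralOrbits.

(** * Weights of loop configurations *)

Section LoopWeights.
Context {R : realType} {d l nS : nat} (beta : R) (h : site d l -> R)
  (s : seq (edge d l * bool * R)).
Hypothesis gs : good_times beta s.
Implicit Types (chi : {ffun hp s -> 'I_nS.+1}) (k : 'I_nS.+1) (y : site d l) (g : hp s).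

Notation m1 := (@M1 R d l beta s).
Notation m2 := (@M2 R d l s).

Lemma M1K : involutive m1.
Proof. by move=> [p []]; rewrite /M1 /= ?(nextK gs) ?(prevK gs). Qed.

Lemma M2K : involutive m2.
Proof.
by move=> [[i b] c]; rewrite /M2 /ep_cross /=; case e : (br i).1.2 => /=; rewrite e !negbK.
Qed.

Lemma M1_fix g : m1 g != g.
Proof. by case: g => p [] /=; rewrite /M1 /= xpair_eqE andbF. Qed.

Lemma M2_fix g : m2 g != g.
Proof.
by case: g => [[i []] c]; rewrite /M2 /=; case: ifP; rewrite !xpair_eqE /= andbF.
Qed.

Lemma sum_hw_loop C : C \in loops beta s -> \sum_(g in C) hw beta h g = loopw beta h C.
Proof.
move=> CL; rewrite big_mkcond /=.
transitivity (\sum_(p : ep s) \sum_b (if (p, b) \in C then hw beta h (p, b) else 0)).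
  by rewrite pair_bigA; apply: eq_bigr => -[].
rewrite (eq_bigr (fun p : ep s => (if (p, true) \in C then hw beta h (p, true) else 0) +
    (if (p, false) \in C then hw beta h (p, false) else 0))); last first.
  by move=> p _; rewrite big_bool.
rewrite big_split /= [X in _ + X](reindex_inj (can_inj (nextK gs))) /= -big_split /=.
rewrite /loopw [RHS]big_mkcond /=; apply: eq_bigr => p _.
have -> : ((Defs.next beta p, false) \in C) = ((p, true) \in C).
  by rewrite -(orbit_mem1 M1K M2K (p, true) CL).
by case: ifP => _; rewrite ?addr0 ?(hw_segment h gs).
Qed.

Lemma sum_block_weight (C : {set hp s}) :
  \sum_(k < nS.+1) \prod_(g in C) expR (spin k * hw beta h g) = zact nS (\sum_(g in C) hw beta h g).
Proof. by apply: eq_bigr => k _; rewrite -expR_sum -mulr_sumr. Qed.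

Lemma bridge_okP chi : bridge_ok chi <-> (forall g, chi (m2 g) = chi g).
Proof.
split=> [/forallP hb [[i b] c]|hb].
  by have /forallP/(_ b)/forallP/(_ c)/eqP := hb i.
by apply/forallP => i; apply/forallP => b; apply/forallP => c; rewrite hb.
Qed.

Definition segment_of g := if g.2 then g.1 else Defs.prev beta g.1.

(** The sum over sites separates the segments through time 0 from the others. Here the two
    conditions are reassembled into invariance under [m1] away from the cut segments. *)
Lemma vertical_cutP (cut : pred (ep s)) chi : (forall p, cut p -> top_ep beta p) ->
  [forall p, vertical_ok beta chi p] &&
  [forall p, top_ep beta p && ~~ cut p ==> (chi (Defs.next beta p, false) == chi (p, true))]
  <-> (forall g, ~~ cut (segment_of g) -> chi (m1 g) = chi g).
Proof.
move=> ct; split=> [/andP[/forallP hv /forallP ht]|hc].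
  have H p : ~~ cut p -> chi (Defs.next beta p, false) = chi (p, true).
    move=> ncp; have := hv (Defs.next beta p); have := ht p.
    rewrite /vertical_ok (low_next_top gs) (nextK gs) ncp andbT.
    by case: (top_ep beta p) => /= [/eqP-> //|_ /eqP].
  by move=> [p []] /= ncp; rewrite /M1 /= ?H// -H// (prevK gs).
apply/andP; split; apply/forallP => p.
  rewrite /vertical_ok (low_prev_top gs); case: (boolP (top_ep beta _)) => //= ntp.
  have := hc (p, false); rewrite /segment_of /M1 /= => -> //.
  by apply: contra ntp => /ct.
by apply/implyP => /andP[_ ncp]; have := hc (p, true) ncp; rewrite /M1 /= => ->.
Qed.

Lemma prod_observable (cut : pred (site d l)) chi :
  \prod_(y | ~~ cut y) observable_factor beta (fun _ k k' => (k == k')%:R) y chi =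
  [forall p, top_ep beta p && ~~ cut (ep_site p) ==>
     (chi (Defs.next beta p, false) == chi (p, true))]%:R :> R.
Proof.
rewrite big_mkcond /=.
pose P y := if lastb s beta y is Some q then
    ~~ cut y ==> (chi (Defs.next beta q, false) == chi (q, true)) else true.
rewrite (eq_bigr (fun y => (P y)%:R)); last first.
  by move=> y _; rewrite /observable_factor /P; case: (lastb _ _ _) => [q|]; case: (cut y).
rewrite (@prodr_bool R _ P) /P; congr (nat_of_bool _)%:R; apply/forallP/forallP => hf.
  move=> p; apply/implyP => /andP[/eqP tp ncp]; have := hf (ep_site p).
  by rewrite tp ncp.
move=> y; case e : (lastb s beta y) => [q|//].
have qy : ep_site q = y by move: e; case: lastbP => // q1 ? _ _ [<-].
by have := hf q; rewrite /top_ep qy e eqxx.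
Qed.

Lemma trace_weightA (w : edge d l * bool -> R) :
  \tr (1 *m wprod (fieldmx h) w (@bridgemx _ _ _ nS) (sort_times [::] s) 0 beta) =
  expR (- beta * #|{: edge d l}|%:R) * weightA nS beta h s.
Proof.
pose X (y : site d l) (k k' : 'I_nS.+1) : R := (k == k')%:R.
have XmE (a sg : conf d l nS) : ent 1 a sg = \prod_y X y (a y) (sg y).
  rewrite /X prodr_bool /ent mxE (can_eq enum_rankK).
  rewrite -mulr_natr mul1r; congr (nat_of_bool _)%:R.
  apply/eqP/forallP => [-> y|e]; first exact: eqxx.
  by apply/ffunP => y; exact/eqP/e.
rewrite (trace_label_sum h w gs XmE) -mulrA; congr (_ * _); rewrite /weightA mulrC.
congr (_ * _); last first.
  by apply: eq_bigr => y _; apply: eq_bigr => k _; rewrite /X eqxx mul1r.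
rewrite -[RHS](eq_bigr _ (fun C CL => congr1 (zact nS) (sum_hw_loop CL))).
rewrite -[RHS](eq_bigr _ (fun C _ => sum_block_weight C)).
rewrite -(sum_const_blocks ord0 (fun g k => expR (spin k * hw beta h g))
  (orbits_partition m1 m2)).
rewrite big_mkcond [RHS]big_mkcond; apply: eq_bigr => chi _.
have po := prod_observable pred0 chi; rewrite /= in po.
rewrite po; set B := [forall p, _ ==> _].
have -> : const_on (orbits m1 m2) chi = bridge_ok chi && [forall p, vertical_ok beta chi p] && B.
  apply/idP/idP => [/(const_orbits M1K M2K)[h2 h1]|].
    rewrite -andbA; apply/andP; split; first exact/bridge_okP.
    by apply/(@vertical_cutP pred0 chi) => //= g _; exact: h1.
  rewrite -andbA => /andP[/bridge_okP h2 hv].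
  apply/(const_orbits M1K M2K); split => // g.
  by have /(@vertical_cutP pred0 chi) := hv; apply.
by case: (_ && _) => //=; case: B; rewrite ?mul1r ?mul0r.
Qed.

End LoopWeights.

(** * Spin-flip matrix elements *)

Section Correlation.
Context {R : realType} {d l nS : nat}.
Implicit Types (k : 'I_nS.+1).

Definition ladder k k' : R :=
  if ((k : nat) == k'.+1) || ((k' : nat) == k.+1)
  then Num.sqrt (Sval nS * (Sval nS + 1) - spin k * spin k') / 2 else 0.

Lemma ladderC k k' : ladder k k' = ladder k' k.
Proof. by rewrite /ladder orbC [spin k * _]mulrC. Qed.

Lemma ladder_diag k : ladder k k = 0.
Proof. by rewrite /ladder orbb ltn_eqF. Qed.

(** The radicand factors as (2S - j)(j + 1), hence is nonnegative; the prefactor of [ztil] is the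
    square of the 1/2 in the matrix elements of S^1. *)
Lemma ladder_sqr (j : 'I_nS) :
  ladder (lift ord0 j) (widen_ord (leqnSn nS) j) ^+ 2 =
  4^-1 * (Sval nS * (Sval nS + 1) - (j%:R - Sval nS) * (j%:R - Sval nS + 1)).
Proof.
rewrite /ladder lift0 eqxx /= /spin lift0 /=.
have -> : (j.+1%:R - Sval nS) * (j%:R - Sval nS) = (j%:R - Sval nS) * (j%:R - Sval nS + 1) :> R.
  by rewrite -natr1; ring.
rewrite exprMn sqr_sqrtr; first by field.
have -> : Sval nS * (Sval nS + 1) - (j%:R - Sval nS) * (j%:R - Sval nS + 1) =
   (nS%:R - j%:R) * (j%:R + 1) :> R by rewrite /Sval; field.
apply: mulr_ge0; last by rewrite addr_ge0.
by rewrite subr_ge0 ler_nat ltnW.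
Qed.

Lemma sum_adjacent (G : 'I_nS.+1 -> 'I_nS.+1 -> R) :
  \sum_(k < nS.+1) \sum_(k' < nS.+1) (if ((k : nat) == k'.+1) || ((k' : nat) == k.+1) then G k k' else 0) =
  \sum_(j < nS) (G (lift ord0 j) (widen_ord (leqnSn nS) j) +
                 G (widen_ord (leqnSn nS) j) (lift ord0 j)).
Proof.
have H (F : 'I_nS.+1 -> 'I_nS.+1 -> R) :
    \sum_(k < nS.+1) \sum_(k' < nS.+1) (if (k : nat) == k'.+1 then F k k' else 0) =
    \sum_(j < nS) F (lift ord0 j) (widen_ord (leqnSn nS) j).
  rewrite big_ord_recl big1 ?add0r//.
  apply: eq_bigr => j _; have jS : bump 0 j = j.+1 by rewrite /bump leq0n add1n.
  rewrite (bigD1 (widen_ord (leqnSn nS) j)) //= jS eqxx big1 ?addr0// => k' nk'.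
  by case: eqP => // -[e]; case/eqP: nk'; apply: val_inj.
rewrite big_split /= -H -(H (fun k k' => G k' k)) [X in _ = _ + X]exchange_big /= -big_split /=.
apply: eq_bigr => k _; rewrite -big_split /=; apply: eq_bigr => k' _.
case: (eqVneq (k : nat) k'.+1) => [e|_] /=; last by rewrite add0r.
have -> : ((k' : nat) == k.+1) = false by apply/eqP; lia.
by rewrite addr0.
Qed.

(** Both flips act between the same two arc labels, hence the square; the two orders of adjacent
    labels give the two exponentials of [ztil]. *)
Lemma sum_ladder (wp wm : R) :
  \sum_k \sum_k' (ladder k k' * ladder k k') *
     (expR (spin k * wp) * expR (spin k' * wm)) = ztil nS wp wm.
Proof.
rewrite (eq_bigr (fun k => \sum_(k' < nS.+1) (if ((k : nat) == k'.+1) || ((k' : nat) == k.+1)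
   then ladder k k' ^+ 2 * (expR (spin k * wp) * expR (spin k' * wm)) else 0))); last first.
  move=> k _; apply: eq_bigr => k' _; rewrite expr2 /ladder; case: ifP => // _.
  by rewrite !mul0r.
rewrite (sum_adjacent (fun k k' => ladder k k' ^+ 2 * (expR (spin k * wp) * expR (spin k' * wm)))).
rewrite /ztil mulr_sumr; apply: eq_bigr => j _.
rewrite [ladder (widen_ord _ _) _]ladderC ladder_sqr -!expRD -mulrDr -mulrA.
congr (_ * (_ * (expR _ + expR _))); rewrite /spin lift0 /= -natr1; ring.
Qed.

Definition corr_site (o x y : site d l) k k' : R :=
  if (y == o) || (y == x) then ladder k k' else (k == k')%:R.

Lemma ent_S1S1 (o x : site d l) (a sg : conf d l nS) : x != o ->
  ent (S1mx nS o *m S1mx nS x) a sg = \prod_y corr_site o x y (a y) (sg y).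
Proof.
move=> xo; rewrite ent_mul.
pose r0 : conf d l nS := [ffun z => if z == o then sg o else a z].
rewrite (bigD1 r0)//= [X in _ + X]big1 ?addr0; last first.
  move=> r nr; rewrite !ent_opmx.
  case: forallP => [h1|_]; last by rewrite !mul0r.
  case: forallP => [h2|_]; last by rewrite !mul0r mulr0.
  case/eqP: nr; apply/ffunP => z; rewrite ffunE; case: eqP => [->|/eqP zo].
    by have := h2 o; rewrite eq_sym xo => /eqP.
  by have := h1 z; rewrite zo => /eqP.
rewrite !ent_opmx (bigD1 o)//= (bigD1 x)//= {1 2}/corr_site !eqxx orbT /=.
have -> : [forall z, (z != o) ==> (a z == r0 z)].
  by apply/forallP => z; apply/implyP => zo; rewrite ffunE (negbTE zo).
rewrite mul1r !ffunE eqxx (negbTE xo) -/(ladder (a o) (sg o)) -/(ladder (a x) (sg x)).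
congr (_ * _); rewrite mulrC; congr (_ * _).
rewrite (eq_bigr (fun y => (a y == sg y)%:R)); last first.
  by move=> y /andP[yo yx]; rewrite /corr_site (negbTE yo) (negbTE yx).
rewrite big_mkcond /=.
rewrite (eq_bigr (fun y => ((y != o) && (y != x) ==> (a y == sg y))%:R)); last first.
  by move=> y _; case: (_ && _).
rewrite prodr_bool; congr (nat_of_bool _)%:R; apply: eq_forallb => z.
rewrite ffunE; have [->|zo] := eqVneq z o; first by rewrite eqxx implybT.
by [].
Qed.

End Correlation.

Lemma sum_shift (V : nmodType) (a b : nat -> V) K :
  \sum_(j < K.+1) (a j + b j.+1) = a 0%N + \sum_(j < K) (b j.+1 + a j.+1) + b K.+1.
Proof.
elim: K => [|K IH]; first by rewrite big_ord1 big_ord0 addr0.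
rewrite big_ord_recr IH [in RHS]big_ord_recr /= -!addrA; congr (_ + (_ + _)).
Qed.

(** * The loop cut at (0,0) and (x,0) *)

Section CutLoop.
Context {R : realType} {d l nS : nat} (beta : R) (h : site d l -> R)
  (s : seq (edge d l * bool * R)).
Hypothesis gs : good_times beta s.
Implicit Types (chi : {ffun hp s -> 'I_nS.+1}) (g : hp s).

Notation m1 := (@M1 R d l beta s).
Notation m2 := (@M2 R d l s).
Notation f := (zigzag m1 m2).
Notation seg := (segment_of beta).

Lemma hw_low (p : ep s) : low_ep p -> hw beta h (p, false) = h (ep_site p) * ep_time p :> R.
Proof. by move=> /eqP lp; rewrite /hw /= /tbelow lp subr0. Qed.

Lemma hw_pair g : hw beta h g + hw beta h (m1 g) = segw beta h (seg g).
Proof.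
case: g => p [] /=; rewrite /M1 /segment_of /=; first exact: hw_segment.
by rewrite -(hw_segment h gs) (prevK gs) addrC.
Qed.

Variable x : site d l.
Hypothesis xo : x != origin d l.
Variables p0 px : ep s.
Hypothesis e0 : lastb s beta (origin d l) = Some p0.
Hypothesis ex : lastb s beta x = Some px.
Let o := origin d l.
Let g0 : hp s := (p0, true).
Let gx : hp s := (px, true).

Lemma cut_site0 : ep_site p0 = o.
Proof. by move: e0; case: lastbP => // q ? _ _ [<-]. Qed.

Lemma cut_sitex : ep_site px = x.
Proof. by move: ex; case: lastbP => // q ? _ _ [<-]. Qed.

Lemma cut_top0 : top_ep beta p0. Proof. by rewrite /top_ep cut_site0 e0. Qed.
Lemma cut_topx : top_ep beta px. Proof. by rewrite /top_ep cut_sitex ex. Qed.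

Lemma cut_ep_neq : px != p0.
Proof. by apply: contraNneq xo => e; rewrite -cut_sitex e cut_site0. Qed.

Lemma cut_gx_g0 : gx != g0. Proof. by rewrite xpair_eqE (negbTE cut_ep_neq). Qed.
Lemma cut_gx_m1 : gx != m1 g0. Proof. by rewrite /M1 /= xpair_eqE andbF. Qed.

Definition cut_ep (p : ep s) := (p == p0) || (p == px).

Lemma cut_epE p : top_ep beta p -> (ep_site p == o) || (ep_site p == x) = cut_ep p.
Proof.
move=> /eqP tp; apply/orP/orP => -[/eqP e|/eqP e]; [left|right|left|right].
- by move: tp; rewrite e e0 => -[->].
- by move: tp; rewrite e ex => -[->].
- by rewrite e cut_site0.
- by rewrite e cut_sitex.
Qed.

Lemma on_gxE (q : ep s) g : on_gx m1 (q, true) g = (seg g == q).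
Proof.
case: g => p [] /=; rewrite /on_gx /M1 /segment_of /= !xpair_eqE ?andbT ?andbF ?orbF//=.
by apply/eqP/eqP => [->|<-]; rewrite ?(nextK gs) ?(prevK gs).
Qed.

Lemma on_cutE g : on_cut m1 g0 gx g = cut_ep (seg g).
Proof. by rewrite /on_cut orbA -/(on_gx m1 g0 g) !on_gxE. Qed.

Definition cut_ok chi := bridge_ok chi && ([forall p, vertical_ok beta chi p] &&
  [forall p, top_ep beta p && ~~ cut_ep p ==> (chi (Defs.next beta p, false) == chi (p, true))]).

Lemma cut_okP chi : cut_ok chi <-> cut_invariant m1 m2 g0 gx chi.
Proof.
have ct p : cut_ep p -> top_ep beta p by case/orP => /eqP->; [exact: cut_top0|exact: cut_topx].
split=> [/andP[/bridge_okP h2 /(vertical_cutP gs chi ct) h1]|[h2 h1]].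
  by split=> // g; rewrite on_cutE; exact: h1.
apply/andP; split; first exact/bridge_okP.
by apply/(vertical_cutP gs chi ct) => g; rewrite -on_cutE; exact: h1.
Qed.

Lemma sum_cut_labels :
  \sum_(chi : {ffun hp s -> 'I_nS.+1} | bridge_ok chi && [forall p, vertical_ok beta chi p])
    (\prod_y observable_factor beta (corr_site o x) y chi) *
    \prod_g expR (spin (chi g) * hw beta h g) =
  \sum_(chi : {ffun hp s -> 'I_nS.+1} | cut_ok chi) (ladder (chi (m1 g0)) (chi g0) * ladder (chi (m1 gx)) (chi gx)) *
    \prod_g expR (spin (chi g) * hw beta h g) :> R.
Proof.
rewrite big_mkcond [RHS]big_mkcond; apply: eq_bigr => chi _.
rewrite (bigD1 o)//= (bigD1 x)//=.
rewrite {1 2}/observable_factor e0 ex {1 2}/corr_site !eqxx orbT /=.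
have -> : \prod_(y | (y != o) && (y != x)) observable_factor beta (corr_site o x) y chi =
  [forall p, top_ep beta p && ~~ cut_ep p ==> (chi (Defs.next beta p, false) == chi (p, true))]%:R :> R.
  rewrite (eq_bigr (fun y => observable_factor beta (fun _ k k' => (k == k')%:R) y chi)); last first.
    move=> y /andP[yo yx]; rewrite /observable_factor; case: (lastb _ _ _) => // q.
    by rewrite /corr_site (negbTE yo) (negbTE yx).
  rewrite (eq_bigl (fun y => ~~ ((y == o) || (y == x)))); last by move=> y; rewrite negb_or.
  rewrite (prod_observable _ (fun y => (y == o) || (y == x))); congr (nat_of_bool _)%:R.
  apply: eq_forallb => p; case: (boolP (top_ep beta p)) => //= tp.
  by rewrite cut_epE.
rewrite /cut_ok; case: (bridge_ok chi) => //=; case: [forall p, vertical_ok _ _ _] => //=.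
by case: [forall p, _]; rewrite /= ?mulr1 ?mulr0 ?mul0r.
Qed.

Lemma sum_cut_disconnected : ~~ connect (lrel beta (s := s)) g0 gx ->
  \sum_(chi : {ffun hp s -> 'I_nS.+1} | cut_ok chi) (ladder (chi (m1 g0)) (chi g0) * ladder (chi (m1 gx)) (chi gx)) *
    \prod_g expR (spin (chi g) * hw beta h g) = 0 :> R.
Proof.
move=> nc; apply: big1 => chi /cut_okP ci.
rewrite (cut_not_connected (M1K gs) (M2K (s := s)) (M1_fix beta (s := s)) (M2_fix (s := s)) nc ci).
by rewrite ladder_diag !mul0r.
Qed.

Let wk k := iter k f (f g0).
Let K := find (fun k => seg (wk k) == px) (iota 0 (4 * size s)).

Definition plus_weight : R :=
  h o * ep_time (Defs.next beta p0) + \sum_(k < K) segw beta h (seg (wk k))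
  + h x * (if (wk K).2 then beta - ep_time px else ep_time (wk K).1).

Lemma sum_cut_connected : connect (lrel beta (s := s)) g0 gx ->
  let C0 := [set g' | connect (lrel beta (s := s)) g0 g'] in
  \sum_(chi : {ffun hp s -> 'I_nS.+1} | cut_ok chi) (ladder (chi (m1 g0)) (chi g0) * ladder (chi (m1 gx)) (chi gx)) *
    \prod_g expR (spin (chi g) * hw beta h g) =
  ztil nS plus_weight (loopw beta h C0 - plus_weight) *
  \prod_(C in loops beta s | C != C0) zact nS (loopw beta h C).
Proof.
move=> cx C0; have k1 := M1K gs; have k2 := M2K (s := s).
have f1 := M1_fix beta (s := s); have f2 := M2_fix (s := s).
have wkE k : wk k = iter k.+1 f g0 by rewrite /wk iterSr.
have hasK : has (fun k => seg (wk k) == px) (iota 0 (4 * size s)).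
  have [j jr hj] := connect_zigzag k1 k2 cx.
  have oj : on_gx m1 gx (iter j f g0).
    by case: hj => e; rewrite /on_gx e ?eqxx// k1 eqxx orbT.
  case: j jr oj {hj} => [|j] jr oj.
    move: oj; rewrite on_gxE /= => /eqP e; have := cut_ep_neq.
    by rewrite -e /segment_of /= eqxx.
  apply/hasP; exists j; last by rewrite wkE -on_gxE.
  (* The search range [4 * size s] is the number of half-points, which bounds the period of the
     walk. *)
  rewrite mem_iota add0n; apply: leq_trans (ltnW jr) _.
  apply: leq_trans (max_card _) _; rewrite !card_prod card_ord card_bool.
  by rewrite -mulnA mulnC.
have Kn : (K < 4 * size s)%N by move: hasK; rewrite has_find size_iota.
have Kgx : on_gx m1 gx (iter K.+1 f g0).
  by have := nth_find 0%N hasK; rewrite -/K nth_iota// add0n wkE -on_gxE.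
have Kmin j : (j < K)%N -> ~~ on_gx m1 gx (iter j.+1 f g0).
  move=> jK; have := before_find 0%N jK.
  by rewrite nth_iota ?(ltn_trans jK)// add0n wkE -on_gxE => ->.
have n1 := cut_gx_g0; have n2 := cut_gx_m1.
have pP := cut_orbits_partition k1 k2 f1 f2 n1 n2 Kgx Kmin.
set P := cut_orbits _ _ _ _ in pP; set A := cut_arc m1 m2 g0 K.
have C0E : [set v | connect (zrel m1 m2) g0 v] = C0 by [].
have AP : A \in P by rewrite finset.in_setU1 eqxx.
have A'P : C0 :\: A \in P by rewrite !finset.in_setU1 eqxx orbT.
have aA : m1 g0 \in A by exact: m1g0_in_arc.
have g0A : g0 \notin A := g0_notin_arc k1 k2 f1 f2 n1 n2 Kgx Kmin.
have g0C : g0 \in C0 by rewrite inE connect0.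
have a'A' : g0 \in C0 :\: A by rewrite finset.in_setD g0A.
have AA' : A != C0 :\: A by apply: contraNneq g0A => ->.
have subA : A \subset C0 by exact: arc_sub.
pose Y (k k' : 'I_nS.+1) : R := ladder k k' * ladder k k'.
transitivity (\sum_(chi : {ffun hp s -> 'I_nS.+1} | const_on P chi) Y (chi (m1 g0)) (chi g0) *
   \prod_g expR (spin (chi g) * hw beta h g)).
  apply: eq_big => [chi|chi /cut_okP ci].
    apply/idP/idP => [/cut_okP ci|].
      exact/(const_cut_orbits k1 k2 f1 f2 n1 n2 Kgx Kmin).
    by move=> /(const_cut_orbits k1 k2 f1 f2 n1 n2 Kgx Kmin) ci; exact/cut_okP.
  congr (_ * _); rewrite /Y; congr (_ * _).
  have ce := arc_const k1 k2 f1 f2 n1 n2 Kgx Kmin ci (end_in_arc m1 m2 g0 K).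
  have ce' : chi (m1 (iter K.+1 f g0)) = chi g0.
    apply: (coarc_const k1 k2 f1 f2 n1 n2 Kgx Kmin ci).
      apply: connect_trans (iter_connect k1 k2 g0 K.+1) _.
      by apply: connect1; rewrite zrelE// eqxx.
    exact: (m1end_notin_arc k1 k2 f1 f2 n1 n2 Kgx Kmin).
  (* The walk may enter the segment through (x,0) from either side; the symmetry of [ladder] covers
     both cases. *)
  case/orP: Kgx => /eqP e; move: ce ce'; rewrite e ?k1 => -> -> //.
  exact: ladderC.
rewrite (sum_const_blocks2 ord0 (fun g k => expR (spin k * hw beta h g)) Y pP AP A'P AA' aA a'A').
have sumA : \sum_(g in A) hw beta h g = plus_weight.
  rewrite (sum_arc k1 k2 f1 f2 n1 n2 Kgx Kmin).
  (* Shifting one of the two families by a step pairs the halves of each full segment; the unpaired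
     first and last terms are the partial segments at (0,0) and (x,0). *)
  rewrite (sum_shift (fun j => hw beta h (m1 (iter j f g0))) (fun j => hw beta h (iter j f g0))).
  congr (_ + _ + _).
  - rewrite /= /M1 /= hw_low; last by rewrite (low_next_top gs) cut_top0.
    by rewrite next_site cut_site0.
  - by apply: eq_bigr => j _; rewrite hw_pair wkE.
  rewrite wkE; case/orP: Kgx => /eqP->.
    by rewrite /hw /= cut_topx cut_sitex.
  rewrite /= /M1 /= hw_low; last by rewrite (low_next_top gs) cut_topx.
  by rewrite next_site cut_sitex.
have sumA' : \sum_(g in C0 :\: A) hw beta h g = loopw beta h C0 - plus_weight.
  have C0L : C0 \in loops beta s by exact: imset_f.
  rewrite -(sum_hw_loop h gs C0L) [X in _ = X - _](big_setID A) /= (finset.setIidPr subA) sumA.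
  by rewrite addrAC subrr add0r.
congr (_ * _).
  rewrite -sum_ladder; apply: eq_bigr => k _; apply: eq_bigr => k' _; congr (_ * _).
  by rewrite -!expR_sum -!mulr_sumr sumA sumA'.
have meet (B : {set hp s}) v : B \in loops beta s -> v \in B -> v \in C0 -> B = C0.
  move=> BL vB vC; have /and3P[_ tP _] := orbits_partition m1 m2.
  rewrite -(def_pblock tP BL vB); apply: (def_pblock tP) => //; exact: imset_f.
rewrite (eq_bigl (fun B : {set hp s} => (B \in loops beta s) && (B != C0))).
  by apply: eq_bigr => B /andP[BL _]; rewrite sum_block_weight (sum_hw_loop h gs BL).
move=> B; rewrite !finset.in_setU1 finset.in_setD1 C0E.
apply/idP/idP => [/andP[/or3P[/eqP->|/eqP->|/andP[-> ->]]]|/andP[BL BC0]] //.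
- by rewrite eqxx.
- by rewrite eqxx andbF.
rewrite BL BC0 !orbT /=; apply/andP; split; apply: contraNneq BC0 => e; apply/eqP.
  by apply: (meet B (m1 g0)) => //; [rewrite e|exact: (fintype.subsetP subA)].
by apply: (meet B g0) => //; rewrite e.
Qed.

End CutLoop.

(** * The two identities of the theorem *)

Section Main.
Context {R : realType} {d l : nat} (nS : nat) (beta u : R) (h : site d l -> R).

Let w (b : edge d l * bool) : R := if b.2 then u else 1 - u.

Lemma trace_weightB (s : seq (edge d l * bool * R)) (x : site d l) :
  good_times beta s -> x != origin d l ->
  \tr (S1mx nS (origin d l) *m S1mx nS x *m
    wprod (fieldmx h) w (@bridgemx _ _ _ nS) (sort_times [::] s) 0 beta) =
  expR (- beta * #|{: edge d l}|%:R) * weightB nS beta h s x.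
Proof.
move=> gs xo; set o := origin d l.
rewrite (trace_label_sum h w gs (fun a sg => ent_S1S1 a sg xo)) -mulrA; congr (_ * _).
(* A site without bridges has equal labels before and after the flip, where [ladder] vanishes; this
   matches the value 0 of [weightB] when [seg0] finds no endpoint. *)
have empty0 z : (z == o) || (z == x) -> lastb s beta z = None ->
    \prod_(y | empty_site s y) (\sum_(k < nS.+1) corr_site o x y k k * expR (spin k * (h y * beta))) = 0 :> R.
  move=> zc ez; have emz : empty_site s z.
    by apply/negPn/negP => /(nonempty_lastb gs)[q]; rewrite ez.
  rewrite (bigD1 z)//= big1 ?mul0r// => k _.
  by rewrite /corr_site zc ladder_diag mul0r.
rewrite /weightB !(seg0E gs) -/o.
case e0 : (lastb s beta o) => [p0|]; last by rewrite (empty0 o) ?eqxx// mul0r.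
case ex : (lastb s beta x) => [px|]; last by rewrite (empty0 x) ?eqxx ?orbT// mul0r.
rewrite (sum_cut_labels h xo e0 ex).
case: ifP => [cx|/negbT ncx]; last first.
  by rewrite (sum_cut_disconnected _ gs e0 ex ncx) mulr0.
rewrite (sum_cut_connected h gs xo e0 ex cx) mulrC; congr (_ * _).
apply: eq_bigr => y ey; apply: eq_bigr => k _.
have yo : y != o by apply/eqP => yo; move: e0; rewrite -yo (empty_lastb _ ey).
have yx : y != x by apply/eqP => yx; move: ex; rewrite -yx (empty_lastb _ ey).
by rewrite /corr_site (negbTE yo) (negbTE yx) eqxx mul1r.
Qed.

Lemma Ham_decomp : - beta *: Ham nS u h =
  beta *: (fieldmx h + \sum_b w b *: @bridgemx R d l nS b).
Proof.
rewrite scaleNr -scalerN; congr (_ *: _); rewrite /Ham opprB opprK.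
have -> : \sum_b w b *: @bridgemx R d l nS b =
   \sum_(e : edge d l) (u *: Tmx nS (val e).1 (val e).2 + (1 - u) *: Qmx nS (val e).1 (val e).2).
  transitivity (\sum_(e : edge d l) \sum_b w (e, b) *: @bridgemx R d l nS (e, b)).
    by rewrite pair_bigA; apply: eq_bigr => -[].
  by apply: eq_bigr => e _; rewrite big_bool.
have cE : #|xpredT : pred (edge d l)| = #|{: edge d l}| by apply: eq_card.
rewrite sumrB sumr_const cE -scaler_nat addrA addrAC; congr (_ + _).
apply/matrixP => i j; rewrite !mxE summxE.
rewrite (eq_bigr (fun y : site d l => (i == j)%:R * (h y * spin (enum_val i y)))); last first.
  by move=> y _; rewrite !mxE (inj_eq enum_val_inj) mulrCA.
rewrite -mulr_sumr -/(energy h (enum_val i)).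
by case: (i == j); rewrite ?mulr1n ?mulr0n ?mul1r ?mul0r ?mulr1 ?mulr0 ?subr0.
Qed.

End Main.

Theorem theorem2p1 (R : realType) (d l nS : nat) (u beta : R)
    (h : site d l -> R) :
  (1 <= d)%N -> 0 <= u <= 1 -> 0 < beta -> (forall y, 0 <= h y) ->
  ((Zpart nS u beta h)%:E =
     rho_int beta u (fun s => (weightA nS beta h s)%:E)) /\
  (forall x : site d l, x != origin d l ->
     (corr11 nS u beta h x)%:E =
       ((Zpart nS u beta h)^-1)%:E *
       rho_int beta u (fun s => (weightB nS beta h s x)%:E))%E.
Proof.
move=> _ _ b0 _.
set c := expR (- beta * #|{: edge d l}|%:R).
have c0 : c != 0 by rewrite gt_eqF ?expR_gt0.
pose w (b : edge d l * bool) : R := if b.2 then u else 1 - u.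
have rhoE (Xm : 'M[R]_#|{: conf d l nS}|) (G : seq (edge d l * bool * R) -> R) :
    (forall s, good_times beta s ->
      \tr (Xm *m wprod (fieldmx h) w (@bridgemx _ _ _ nS) (sort_times [::] s) 0 beta) = c * G s) ->
    rho_int beta u (fun s => (G s)%:E) = (\tr (Xm *m expmx (- beta *: Ham nS u h)))%:E.
  (* The ordered product gives [c * G s] while the Poisson law brings its own factor [c]; rescaling
     the observable by the inverse of [c] cancels the two. *)
  move=> hG; rewrite (@rho_int_trace R _ (fieldmx h) (edge d l) beta u (@bridgemx _ _ _ nS)
     (c^-1 *: Xm)) // => [|s gs]; last first.
    by rewrite -scalemxAl mxtraceZ hG// mulKf.
  by rewrite -/w -Ham_decomp -scalemxAl mxtraceZ mulVKf.
split=> [|x xo].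
  rewrite (rhoE 1) ?mul1mx// => s gs; exact: trace_weightA.
rewrite (rhoE (S1mx nS (origin d l) *m S1mx nS x)) => [|s gs]; last exact: trace_weightB.
by rewrite -EFinM /corr11 mulrC.
Qed.
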